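(* Let $X_1, X_2, \dots$ be i.i.d. standard exponential random variables and let $S_i = X_1 + \dots + X_i$ for $i \ge 1$. Then for every $t$ with $0 \le t \le 1$, $$\mathbb{P}\left\{ \inf_{k \ge 1} \frac{2}{k(k+1)} \sum_{i=1}^k S_i \ge t \right\} = \mathbb{P}\left\{ \inf_{k \ge 1} \sum_{i=1}^k (S_i - it) \ge 0 \right\} = \sqrt{1-t}\; e^{-t/2}.$$
   Context: A standard exponential random variable has density $e^{-x}$ on $[0,\infty)$ (mean one). *)

(* Defs.v *)
From mathcomp Require Import all_boot all_order all_algebra finmap.
From mathcomp Require Import all_classical all_reals all_analysis.
Set Implicit Arguments.
Unset Strict Implicit.
Unset Printing Implicit Defensive.
Import Order.TTheory GRing.Theory Num.Theory.
Import numFieldNormedType.Exports.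

Local Open Scope classical_set_scope.
Local Open Scope ring_scope.

(* Mutual independence: the product rule over every finite subfamily. *)
Definition independent_RVs (d : measure_display) (T : measurableType d)
    (R : realType) (P : probability T R) (I : choiceType)
    (X : I -> {RV P >-> R}) : Prop :=
  forall (J : {fset I}) (B : I -> set R),
    (forall i, i \in J -> measurable (B i)) ->
    P (\bigcap_(i in [set` J]) (X i @^-1` B i)) =
      (\prod_(i <- J) P (X i @^-1` B i))%E.

(* The density of exponential_prob 1 is expR (- x) on [0, +oo[. *)
Definition std_exponential (d : measure_display) (T : measurableType d)
    (R : realType) (P : probability T R) (X : {RV P >-> R}) : Prop :=
  forall B : set R, measurable B -> distribution P X B = exponential_prob 1 B.

Definition iid_std_exponential (d : measure_display) (T : measurableType d)
    (R : realType) (P : probability T R) (X : nat -> {RV P >-> R}) : Prop :=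
  independent_RVs X /\ forall i, std_exponential (X i).

(* The family X is numbered from 0, so X j is the (j+1)-st variable and
   psum X i is the sum of the first i variables. *)
Definition psum (d : measure_display) (T : measurableType d)
    (R : realType) (P : probability T R) (X : nat -> {RV P >-> R})
    (i : nat) (w : T) : R :=
  \sum_(j < i) X j w.

(* Main.v *)
From HB Require Import structures.
Require Import Defs.
From mathcomp Require Import all_boot all_order all_algebra finmap.
From mathcomp Require Import all_classical all_reals all_analysis.
From mathcomp Require Import measurable_realfun.
From mathcomp Require Import ring lra zify.
Set Implicit Arguments.
Unset Strict Implicit.
Unset Printing Implicit Defensive.
Import Order.TTheory GRing.Theory Num.Theory.
Import numFieldNormedType.Exports.

Local Open Scope classical_set_scope.
Local Open Scope ring_scope.

(** Let [Y] be the iterated sum Y_k = sum over i <= k of (S_i - i t), whose second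
    differences are X_i - t, and restrict it to [0, N].  Call i a contact when
    (i, Y_i) lies on the convex minorant of Y.  That i is a contact, or that i < j
    are consecutive contacts, is expressed by conditions of the form X_i >= A with
    A >= 0 independent of X_i, so lack of memory factorizes the probabilities.
    With a_n = e^t P(Y_1, ..., Y_n >= 0),
      P(contact at i)              = e^-t a_i a_(N-i),
      P(i, i+m consecutive)        = e^-t a_i v_m a_(N-i-m),
    where v_m = V_m t^(m-1) e^(-m t) and V_m, the volume of a polytope of gaps,
    does not depend on t.  Since the number of contacts minus the number of
    consecutive pairs is 1 as soon as there is a contact,
      1 - P(no contact) = e^-t (a * a - a * v * a)_N,
    and P(no contact) decays geometrically for t < 1 by a Chernoff bound, which
    also shows that a_n stays away from 0.  Letting the variable of the
    generating functions tend to 1 gives sum of v_m = 1, that is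
    F(t e^-t) = t with F(z) the sum of V_m z^m, for every t in (0, 1).  This
    determines v at smaller arguments, hence lim a_n = sqrt(e^t (1 - t)), and
    the cases t = 0, 1 follow by monotonicity in t. *)

(** * Independence *)

(** The renewal identity is one equation for two unknown sequences, a and v. It can be solved
    because t enters v only through t^(m-1) e^(-m t): the equation at t, taken at s < 1, involves
    the same F as the equations at smaller arguments. For the limit, take s = (1 - d/t) e^d, so that
    t e^-t s = (t-d) e^-(t-d) and the sum of v_m s^m is exactly (t-d)/t. With G = s/(1-s), A the sum
    of a_n s^n and C the bounded contribution of P(no contact), the identity becomes G - C = e^-t
    A^2 d/t. Since a_n is nonincreasing, A is squeezed between r G, for any lower bound r of the
    a_n, and n + a_n G, for any n. As d tends to 0, A behaves like (lim a_n) G and G like t/(d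
    (1-t)), whence e^-t (lim a_n)^2 = 1 - t. Contacts are counted at interior times only; X_0 merely
    tilts the path, so contacts do not depend on it, and it enters only through the survival
    probability. *)

Section independence.
Context d (T : measurableType d) (R : realType) (P : probability T R).
Variable X : nat -> {RV P >-> R}.

(* The finite-dimensional boxes in the coordinates selected by [Q]: a
   pi-system generating the sigma-algebra of the X k with Q k. *)
Definition cylinder (Q : pred nat) : set (set T) := [set A | exists N B,
  [/\ forall k : nat, measurable (B k : set R),
      forall k, (N <= k)%N -> B k = setT &
      A = \bigcap_(k in [set k | Q k]) X k @^-1` B k]].

(** The same points with a coarser sigma-algebra, so that depending only on the coordinates in [Q]
    becomes an ordinary measurability statement. *)
Definition coordT (Q : pred nat) : measurableType (cylinder Q).-sigma :=
  g_sigma_algebraType (cylinder Q).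

Lemma cylinder_setI_closed (Q : pred nat) : setI_closed (cylinder Q).
Proof.
move=> _ _ [N [B [mB BT ->]]] [M [C [mC CT ->]]].
exists (maxn N M), (fun k => B k `&` C k); split.
- by move=> k; exact: measurableI.
- by move=> k; rewrite geq_max => /andP[? ?]; rewrite BT// CT// setTI.
- by rewrite -bigcapI; apply: eq_bigcapr => k _; rewrite preimage_setI.
Qed.

Lemma cylinder_coord (Q : pred nat) k (B : set R) : Q k -> measurable B ->
  cylinder Q (X k @^-1` B).
Proof.
move=> Qk mB; exists k.+1, (fun j => if j == k then B else setT); split.
- by move=> j; case: ifP.
- by move=> j; case: eqP => // ->; rewrite ltnn.
- apply/seteqP; split=> [w Xw j _ /=|w /(_ k Qk)]; last by rewrite /= eqxx.
  by case: eqP => // ->.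
Qed.

Lemma cylinder_measurable Q : cylinder Q `<=` measurable.
Proof.
move=> _ [N [B [mB _ ->]]]; apply: bigcap_measurableType => k _.
by rewrite -[X in measurable X]setTI; exact: measurable_funP.
Qed.

Lemma coordT_measurable Q A :
  measurable (A : set (coordT Q)) -> measurable (A : set T).
Proof.
apply: smallest_sub; last exact: cylinder_measurable.
exact: sigma_algebra_measurable.
Qed.

Lemma measurable_id_coordT Q : measurable_fun [set: T] (id : T -> coordT Q).
Proof. by move=> _ A mA; rewrite setTI; exact: coordT_measurable mA. Qed.

Lemma measurable_coord (Q : pred nat) k : Q k ->
  measurable_fun [set: coordT Q] (X k : coordT Q -> R).
Proof.
move=> Qk _ B mB; rewrite setTI; apply: sub_sigma_algebra.
exact: cylinder_coord.
Qed.

Hypothesis indX : independent_RVs X.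

Lemma cylinder_probability (Q : pred nat) N (B : nat -> set R) :
  (forall k, measurable (B k)) -> (forall k, (N <= k)%N -> B k = setT) ->
  P (\bigcap_(k in [set k | Q k]) X k @^-1` B k) =
  (\prod_(k < N | Q k) P (X k @^-1` B k))%E.
Proof.
move=> mB BT.
pose s := [seq k <- iota 0 N | Q k].
have JE k : (k \in seq_fset tt s) = Q k && (k < N)%N.
  by rewrite seq_fsetE mem_filter mem_iota.
have -> : \bigcap_(k in [set k | Q k]) X k @^-1` B k =
    \bigcap_(k in [set` seq_fset tt s]) X k @^-1` B k.
  apply/seteqP; split=> w Aw k /= Qk.
    by apply: Aw; have := JE k; rewrite [_ \in _]Qk => /esym/andP[].
  have [Nk|kN] := leqP N k; first by rewrite BT.
  by apply: Aw; have := JE k; rewrite Qk kN.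
rewrite indX; last by move=> k _; exact: mB.
rewrite (perm_big _ (seq_fset_perm _ s)) undup_id ?filter_uniq ?iota_uniq//.
by rewrite big_filter -(big_mkord (fun k => Q k) (fun k => P (X k @^-1` B k)))
  /index_iota subn0.
Qed.

Lemma cylinder_indep (Q Q' : pred nat) A B : (forall k, Q k -> ~~ Q' k) ->
  cylinder Q A -> cylinder Q' B -> P (A `&` B) = (P A * P B)%E.
Proof.
move=> QQ' [N [C [mC CT ->]]] [M [D [mD DT ->]]].
pose E k := if Q k then C k else D k.
have QE k : Q k -> E k = C k by rewrite /E => ->.
have Q'E k : Q' k -> E k = D k.
  by rewrite /E; case: ifP => // /QQ' /negbTE ->.
pose L := maxn N M.
have CL k : (L <= k)%N -> C k = setT by rewrite geq_max => /andP[/CT].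
have DL k : (L <= k)%N -> D k = setT by rewrite geq_max => /andP[_ /DT].
have EL k : (L <= k)%N -> E k = setT.
  by move=> Lk; rewrite /E; case: ifP => _; [exact: CL|exact: DL].
have mE k : measurable (E k) by rewrite /E; case: ifP.
have -> : (\bigcap_(k in [set k | Q k]) X k @^-1` C k) `&`
    (\bigcap_(k in [set k | Q' k]) X k @^-1` D k) =
    \bigcap_(k in [set k | Q k || Q' k]) X k @^-1` E k.
  apply/seteqP; split=> [w [CA DB] k /=|w EAB].
    case/orP=> [Qk|Q'k]; first by rewrite QE//; exact: CA.
    by rewrite Q'E//; exact: DB.
  split=> k /= Qk; first by rewrite -QE//; apply: EAB; rewrite /= Qk.
  by rewrite -Q'E//; apply: EAB; rewrite /= Qk orbT.
rewrite (cylinder_probability _ mE EL) (cylinder_probability _ mC CL).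
rewrite (cylinder_probability _ mD DL).
rewrite (bigID (fun k : 'I_L => Q k)) /=; congr (_ * _)%E.
  rewrite (eq_bigl (fun k : 'I_L => Q k)); last first.
    by move=> k; case: (Q k); rewrite ?andbF.
  by apply: eq_bigr => k Qk; rewrite QE.
rewrite (eq_bigl (fun k : 'I_L => Q' k)); last first.
  move=> k; case: (boolP (Q k)) => /= [/QQ' /negbTE ->//|_].
  by rewrite andbT.
by apply: eq_bigr => k Qk; rewrite Q'E.
Qed.

(** Dynkin's argument: the events that satisfy the product rule against a fixed [B] form a
    lambda-system, which contains the sigma-algebra as soon as it contains the pi-system [G]. *)
Lemma sigma_cylinder_indep_aux (G : set (set T)) (B : set T) :
  G `<=` measurable -> setI_closed G -> measurable B ->
  (forall A, G A -> P (A `&` B) = (P A * P B)%E) ->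
  forall A, <<s G >> A -> P (A `&` B) = (P A * P B)%E.
Proof.
move=> Gm GI mB GB A GA.
have mG := smallest_sub (@sigma_algebra_measurable _ T) Gm.
suff: <<s G >> `<=` [set A | measurable A /\ P (A `&` B) = (P A * P B)%E].
  by move=> /(_ _ GA)[].
apply: lambda_system_subset => //; last by move=> C GC; split; [exact: Gm|exact: GB].
apply/dynkin_lambda_system; split.
- by rewrite /= setTI probability_setT mul1e.
- move=> C [mC PC]; split; first exact: measurableC.
  rewrite setIC -setDE measureD// ?(le_lt_trans (probability_le1 _ _)) ?ltry//.
  transitivity (P B - P C * P B)%E; first by rewrite -PC setIC.
  rewrite probability_setC// muleBl ?fin_num_adde_defr ?mul1e//.
  exact: fin_num_measure.
- move=> F tF HF; have mF k : measurable (F k) by have [] := HF k.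
  split; first exact: bigcupT_measurable.
  rewrite setI_bigcupl measure_bigcup//=; last 2 first.
  + by move=> k _; exact: measurableI.
  + by apply: trivIset_setIr.
  rewrite measure_bigcup//=.
  have -> : (\sum_(k <oo | k \in [set: nat]) P (F k `&` B))%E =
     (\sum_(k <oo | k \in [set: nat]) (P B * P (F k)))%E.
    by apply: eq_eseriesr => k _; rewrite (HF k).2 muleC.
  by rewrite -(fineK (fin_num_measure P B mB)) nneseriesZl// muleC.
Qed.

(** The product rule is extended from cylinders in two passes: the second event ranges over its
    sigma-algebra while the first is still a cylinder, then the first event follows. *)
Lemma coordT_indep (Q Q' : pred nat) A B : (forall k, Q k -> ~~ Q' k) ->
  measurable (A : set (coordT Q)) -> measurable (B : set (coordT Q')) ->
  P (A `&` B) = (P A * P B)%E.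
Proof.
move=> QQ' mA mB.
apply: (@sigma_cylinder_indep_aux (cylinder Q)) => //.
- exact: cylinder_measurable.
- exact: cylinder_setI_closed.
- exact: coordT_measurable mB.
- move=> C QC; rewrite setIC muleC.
  apply: (@sigma_cylinder_indep_aux (cylinder Q')) => //.
  + exact: cylinder_measurable.
  + exact: cylinder_setI_closed.
  + exact: cylinder_measurable QC.
  + by move=> D QD; rewrite setIC muleC; exact: cylinder_indep QQ' QC QD.
Qed.

End independence.

(** * Integrals over independent blocks of coordinates *)

Section independent_integrals.
Context d (T : measurableType d) (R : realType) (P : probability T R).
Variable X : nat -> {RV P >-> R}.
Hypothesis indX : independent_RVs X.
Local Open Scope ereal_scope.

Definition to_coordT (Q : pred nat) : T -> coordT X Q := id.

HB.instance Definition _ Q := isMeasurableFun.Build _ _ _ _ (to_coordT Q)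
  (@measurable_id_coordT _ _ _ _ X Q).

(** The diagonal, as a map into the product of two coarser spaces. For disjoint [Q] and [Q'] its law
    is a product measure, so Tonelli splits one sample point into two independent ones. *)
Definition pair_coordT (Q Q' : pred nat) (w : T) : coordT X Q * coordT X Q' := (w, w).

Lemma measurable_pair_coordT Q Q' : measurable_fun [set: T] (pair_coordT Q Q').
Proof.
apply/measurable_fun_pair; first exact: measurable_id_coordT.
exact: measurable_id_coordT.
Qed.

HB.instance Definition _ Q Q' := isMeasurableFun.Build _ _ _ _
  (pair_coordT Q Q') (@measurable_pair_coordT Q Q').

Lemma ge0_integral_coordT Q (f : T -> \bar R) :
  measurable_fun [set: coordT X Q] (f : coordT X Q -> \bar R) ->
  (forall w, 0 <= f w) ->
  \int[distribution P (to_coordT Q)]_w f w = \int[P]_w f w.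
Proof. by move=> mf f0; rewrite ge0_integral_distribution. Qed.

Lemma ge0_integral_indep (Q Q' : pred nat) (f : T * T -> \bar R) :
  (forall k, Q k -> ~~ Q' k) ->
  measurable_fun [set: coordT X Q * coordT X Q']
    (f : coordT X Q * coordT X Q' -> \bar R) ->
  (forall u, 0 <= f u) ->
  \int[P]_w f (w, w) = \int[P]_w \int[P]_w' f (w, w').
Proof.
move=> QQ' mf f0.
pose m1 := distribution P (to_coordT Q).
pose m2 := distribution P (to_coordT Q').
have -> : \int[P]_w f (w, w) = \int[distribution P (pair_coordT Q Q')]_u f u.
  by rewrite ge0_integral_distribution.
have -> : \int[distribution P (pair_coordT Q Q')]_u f u =
    \int[(m1 \x m2)%E]_u f u.
  apply: eq_measure_integral => A mA _; apply/esym.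
  apply: product_measure_unique => // B C mB mC.
  exact: (coordT_indep indX QQ' mB mC).
rewrite (@fubini_tonelli1 _ _ _ _ _ m1 m2 f mf f0).
rewrite ge0_integral_coordT//; last 2 first.
  by apply: measurable_fun_fubini_tonelli_F.
  by move=> w; apply: integral_ge0 => w' _.
apply: eq_integral => w _; rewrite /fubini_F ge0_integral_coordT//.
exact: measurableT_comp.
Qed.

Lemma ge0_integral_indepM (Q Q' : pred nat) (f g : T -> \bar R) :
  (forall k, Q k -> ~~ Q' k) ->
  measurable_fun [set: coordT X Q] (f : coordT X Q -> \bar R) ->
  measurable_fun [set: coordT X Q'] (g : coordT X Q' -> \bar R) ->
  (forall w, 0 <= f w) -> (forall w, 0 <= g w) ->
  \int[P]_w (f w * g w) = \int[P]_w f w * \int[P]_w g w.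
Proof.
move=> QQ' mf mg f0 g0.
rewrite (@ge0_integral_indep Q Q' (fun u => f u.1 * g u.2))//; last 2 first.
- apply: emeasurable_funM; first exact: measurableT_comp mf _.
  exact: measurableT_comp mg _.
- by move=> u; rewrite mule_ge0.
have mgT : measurable_fun [set: T] g.
  exact: (measurableT_comp mg (@measurable_id_coordT _ _ _ _ X Q')).
have mfT : measurable_fun [set: T] f.
  exact: (measurableT_comp mf (@measurable_id_coordT _ _ _ _ X Q)).
under eq_integral do rewrite /= ge0_integralZl//.
by rewrite ge0_integralZr// integral_ge0.
Qed.

End independent_integrals.

(** * Exponential law *)

Section density.
Context d (T : measurableType d) (R : realType).
Variables (mu nu : {measure set T -> \bar R}) (g : T -> R).
Hypothesis mg : measurable_fun [set: T] g.
Hypothesis g0 : forall x, 0 <= g x.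
Hypothesis nuE : forall A, measurable A -> nu A = (\int[mu]_(x in A) (g x)%:E)%E.
Local Open Scope ereal_scope.
Import HBNNSimple.

(** Both sides are limits along the same increasing simple functions, for which the identity reduces
    to [nuE] on level sets. *)
Lemma ge0_integral_density (f : T -> \bar R) :
  measurable_fun [set: T] f -> (forall x, 0 <= f x) ->
  \int[nu]_x f x = \int[mu]_x (f x * (g x)%:E).
Proof.
move=> mf f0; pose h := nnsfun_approx measurableT mf.
have hf x : (EFin \o h n) x @[n --> \oo] --> f x.
  by apply: cvg_nnsfun_approx => // y _; exact: f0.
have nd_h x : {homo (fun n => (EFin \o h n) x) : n m / (n <= m)%N >-> n <= m}.
  by move=> a b ab; rewrite lee_fin; exact/lefP/nd_nnsfun_approx.
have mhg n : measurable_fun [set: T] (fun x => (h n x)%:E * (g x)%:E).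
  by apply: emeasurable_funM; exact/measurable_EFinP.
have -> : \int[nu]_x f x = limn (fun n => \int[nu]_x (EFin \o h n) x).
  rewrite -monotone_convergence//=.
  - by apply: eq_integral => x _; apply/esym/cvg_lim => //; exact: hf.
  - by move=> n; exact/measurable_EFinP.
  - by move=> n x _; rewrite lee_fin.
  - by move=> x _; exact: nd_h.
have -> : \int[mu]_x (f x * (g x)%:E) =
    limn (fun n => \int[mu]_x ((h n x)%:E * (g x)%:E)).
  rewrite -monotone_convergence//=.
  - apply: eq_integral => x _; apply/esym/cvg_lim => //.
    by apply: cvgeZr => //; exact: hf.
  - by move=> n x _; rewrite mule_ge0 ?lee_fin.
  - move=> x _ a b ab; rewrite lee_wpmul2r ?lee_fin//.
    by have := nd_h x _ _ ab; rewrite lee_fin.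
congr (limn _); apply/funext => n.
rewrite integralT_nnsfun sintegralE.
under [RHS]eq_integral.
  move=> x _; rewrite fimfunE -fsumEFin// ge0_mule_fsuml; last first.
    by move=> r; exact: nnfun_muleindic_ge0.
  over.
rewrite ge0_integral_fsum//; last 2 first.
- move=> r; apply: emeasurable_funM; last exact/measurable_EFinP.
  by apply/measurable_EFinP; exact: measurable_funM.
- move=> r x _; apply: mule_ge0; last by rewrite lee_fin.
  exact: nnfun_muleindic_ge0.
apply: eq_fsbigr => r _.
have mhr : measurable (h n @^-1` [set r]) by exact: measurable_sfunP.
have [r0|r0] := ltP r 0%R.
  rewrite preimage_nnfun0// measure0 mule0; apply/esym/integral0_eq => x _.
  by rewrite indicE in_set0 mulr0 mul0e.
rewrite nuE// integral_mkcond.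
under [RHS]eq_integral do rewrite EFinM -muleA.
rewrite ge0_integralZl//; last 2 first.
- by apply: emeasurable_funM; exact/measurable_EFinP.
- by move=> x _; rewrite mule_ge0 ?lee_fin.
congr (_ * _); apply: eq_integral => x _.
by rewrite patchE indicE; case: ifPn => _; rewrite ?mul1e ?mul0e.
Qed.

End density.

Section lebesgue_scale.
Context (R : realType).
Local Open Scope ereal_scope.
Local Notation mu := (@lebesgue_measure R).

(** Lebesgue measure is determined by its values on half-open intervals, and its image under
    division by [t], multiplied by 1/t, takes the same values there. *)
Lemma ge0_integral_lebesgue_scale (t : R) (g : R -> \bar R) : (0 < t)%R ->
  measurable_fun [set: R] g -> (forall x, 0 <= g x) ->
  \int[mu]_x g (t^-1 * x)%R = t%:E * \int[mu]_x g x.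
Proof.
move=> t0 mg g0; have tV0 : (0 < t^-1)%R by rewrite invr_gt0.
pose s : measurableTypeR R -> measurableTypeR R := fun x => (t^-1 * x)%R.
have ms : measurable_fun [set: measurableTypeR R] s.
  exact: (mulrl_measurable t^-1).
pose nu := pushforward mu s.
have nu_unique A : measurable A -> mu A = mscale (NngNum (ltW tV0)) nu A.
  apply: lebesgue_measure_unique => _ [[a b] _ <-] /=.
  rewrite /mscale /= /nu /pushforward.
  have -> : s @^-1` `]a, b] = `](t * a)%R, (t * b)%R]%classic.
    by apply/seteqP; split=> x /=; rewrite !in_itv/= /s ltr_pdivlMl// ler_pdivrMl.
  rewrite !lebesgue_measure_itv/= !lte_fin ltr_pM2l//.
  case: ifPn => _; last by rewrite mule0.
  by rewrite -!EFinD -EFinM -mulrBr mulKf// gt_eqF.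
rewrite [in RHS](@eq_measure_integral _ _ _ _ _ _ _ (fun A mA _ => nu_unique ms A mA)).
rewrite ge0_integral_mscale//=.
transitivity (t%:E * ((t^-1)%:E * \int[mu]_x g (t^-1 * x)%R)).
  by rewrite muleA -EFinM mulfV ?gt_eqF// mul1e.
congr (_ * (_ * _)); apply/esym.
have g0' : {in [set: measurableTypeR R], forall y, 0 <= g y} by [].
exact: (@ge0_integral_pushforward _ _ _ _ _ _ ms mu setT g measurableT mg g0').
Qed.

End lebesgue_scale.

Section exponential_law.
Context d (T : measurableType d) (R : realType) (P : probability T R).
Variable X : {RV P >-> R}.
Hypothesis expX : std_exponential X.
Local Open Scope ereal_scope.
Local Notation mu := (@lebesgue_measure R).

Let XR : T -> measurableTypeR R := X.

Let measurable_XR : measurable_fun [set: T] XR.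
Proof. exact: (measurable_funP X). Qed.

HB.instance Definition _ := isMeasurableFun.Build _ _ _ _ XR measurable_XR.

Lemma ge0_integral_std_exponential (f : R -> \bar R) :
  measurable_fun [set: R] f -> (forall x, 0 <= f x) ->
  \int[P]_w f (X w) = \int[mu]_x (f x * (exponential_pdf 1 x)%:E).
Proof.
move=> mf f0.
rewrite -(@ge0_integral_density _ _ _ mu (distribution P XR))//.
- by rewrite ge0_integral_distribution.
- exact: measurable_exponential_pdf.
- by move=> x; exact: exponential_pdf_ge0.
Qed.

Lemma std_exponential_tail (a : R) : (0 <= a)%R ->
  P [set w | a <= X w]%R = (expR (- a))%:E.
Proof.
move=> a0.
have -> : P [set w | a <= X w]%R = exponential_prob 1 `[a, +oo[%classic.
  rewrite -expX//; congr (P _); apply/seteqP.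
  by split=> w /=; rewrite in_itv/= andbT.
have cexp : continuous (fun z : R^o => expR (- 1 * z)%R).
  move=> z; apply: continuous_comp; last exact: continuous_expR.
  by apply: continuousM => //; apply: (@continuousN _ R^o); exact: cst_continuous.
rewrite /exponential_prob.
rewrite (@ge0_continuous_FTC2y _ _ (fun x => - expR (- 1 * x))%R _ 0%R)//.
- by rewrite sub0e mulN1r EFinN oppeK.
- by move=> x _; exact: exponential_pdf_ge0.
- apply: (@continuous_subspaceW R^o _ _ [set` `[0%R, +oo[%R]).
    by apply: subset_itvr; rewrite bnd_simp.
  exact: within_continuous_exponential_pdf.
- rewrite -oppr0; apply: cvgN.
  rewrite (_ : (fun x => expR (- 1 * x)%R) = (fun z => expR (- z)%R)).
    exact: cvgr_expR.
  by apply/funext => x; rewrite mulN1r.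
- by apply: cvgN; apply/cvg_at_right_filter; exact: cexp.
- move=> z; rewrite in_itv/= andbT => az; apply: derive1_exponential_pdf.
  by rewrite in_itv/= andbT (le_lt_trans a0).
Qed.

Lemma std_exponential_laplace (c : R) : (0 <= c)%R ->
  \int[P]_w (expR (- (c * X w)))%:E = ((1 + c)^-1)%:E.
Proof.
move=> c0; have c1 : (0 < 1 + c)%R by rewrite ltr_pwDl.
rewrite (@ge0_integral_std_exponential (fun x => (expR (- (c * x)))%:E))//.
  transitivity (\int[mu]_x (((1 + c)^-1)%:E * (exponential_pdf (1 + c) x)%:E)).
    apply: eq_integral => x _; rewrite -!EFinM; congr EFin.
    rewrite /exponential_pdf !patchE; case: ifPn => _; last by rewrite !mulr0.
    rewrite !mul1r mulrA mulVf ?gt_eqF// mul1r -expRD; congr expR.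
    ring.
  rewrite ge0_integralZl ?integral_exponential_pdf ?mule1//.
  - by apply/measurable_EFinP; exact: measurable_exponential_pdf.
  - by move=> x _; rewrite lee_fin exponential_pdf_ge0// ltW.
  - by rewrite lee_fin invr_ge0 ltW.
apply/measurable_EFinP; apply: measurableT_comp => //.
by apply: measurableT_comp => //; exact: mulrl_measurable.
Qed.

(** The factor e^x cancels the exponential density and leaves Lebesgue measure on the half-line,
    which scales by [t]. *)
Lemma std_exponential_scale (t : R) (g : R -> \bar R) : (0 < t)%R ->
  measurable_fun [set: R] g -> (forall x, 0 <= g x) ->
  \int[P]_w ((expR (X w))%:E * g (t^-1 * X w)%R) =
  t%:E * \int[P]_w ((expR (X w))%:E * g (X w)).
Proof.
move=> t0 mg g0.
have mexp : measurable_fun [set: R] (EFin \o expR).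
  by apply/measurable_EFinP; exact: measurable_expR.
have mgt : measurable_fun [set: R] (fun x => g (t^-1 * x)%R).
  by apply: measurableT_comp => //; exact: mulrl_measurable.
rewrite (@ge0_integral_std_exponential
    (fun x => (expR x)%:E * g (t^-1 * x)%R)); last 2 first.
- exact: emeasurable_funM.
- by move=> x; rewrite mule_ge0// lee_fin expR_ge0.
rewrite (@ge0_integral_std_exponential (fun x => (expR x)%:E * g x)); last 2 first.
- exact: emeasurable_funM.
- by move=> x; rewrite mule_ge0// lee_fin expR_ge0.
pose h (x : R) := (\1_(`[0%R, +oo[%classic : set R) x)%:E * g x.
have exppdf (x : R) : (expR x)%:E * (exponential_pdf 1 x)%:E =
    (\1_(`[0%R, +oo[%classic : set R) x)%:E.
  rewrite -EFinM /exponential_pdf patchE indicE; case: ifPn => _; last by rewrite mulr0.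
  by rewrite mul1r mulN1r expRN mulfV ?gt_eqF ?expR_gt0.
transitivity (\int[mu]_x h (t^-1 * x)%R).
  apply: eq_integral => x _; rewrite /h muleAC exppdf; congr (_%:E * _).
  rewrite !indicE !mem_setE; congr (nat_of_bool _)%:R.
  by rewrite !in_itv/= !andbT pmulr_rge0// invr_gt0.
rewrite ge0_integral_lebesgue_scale//; last 2 first.
- by apply: emeasurable_funM => //; exact/measurable_EFinP.
- by move=> x; rewrite mule_ge0// lee_fin.
by congr (_ * _); apply: eq_integral => x _; rewrite /h muleAC exppdf.
Qed.

End exponential_law.

(** * Finite blocks of the i.i.d. sequence *)

Section tuple_law.
Context d (T : measurableType d) (R : realType) (P : probability T R).
Implicit Types X Y : nat -> {RV P >-> R}.
Local Open Scope ereal_scope.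

(** This gives access to shifted and reversed blocks; injectivity keeps distinct indices distinct in
    the product rule. *)
Lemma iid_std_exponential_comp X (k : nat -> nat) : injective k ->
  iid_std_exponential X -> iid_std_exponential (fun i => X (k i)).
Proof.
move=> k_inj [indX expX]; split=> [J B mB|i]; last exact: expX.
pose C j := \bigcap_(i in [set i | k i = j /\ i \in J]) B i.
have CE i : i \in J -> C (k i) = B i.
  move=> iJ; apply/seteqP; split=> [x /(_ i)|x Bx _ [/k_inj -> _]//]; exact.
have := indX [fset k i | i in J]%fset C.
rewrite big_imfset/=; last by move=> i j _ _; exact: k_inj.
rewrite (eq_big_seq (fun i => P (X (k i) @^-1` B i))); last first.
  by move=> i iJ; rewrite CE.
move=> <-; last by move=> j _; apply: bigcap_measurableType => i [_ /mB].
congr (P _); apply/seteqP; split=> [w Bw _ /= /imfsetP[i /= iJ ->]|w Bw i /= iJ].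
  by rewrite CE//; exact: Bw.
by rewrite -(CE _ iJ); apply: Bw => /=; apply/imfsetP; exists i.
Qed.

Definition scaled_tuple X n (r : R) (w : T) : n.-tuple R :=
  [tuple (r * X i w)%R | i < n].
Arguments scaled_tuple : simpl never.

Lemma measurable_scaled_tuple X (Q : pred nat) n r :
  (forall i, (i < n)%N -> Q i) ->
  measurable_fun [set: coordT X Q] (scaled_tuple X n r : coordT X Q -> _).
Proof.
move=> Qn; apply/measurable_fun_tnthP => i.
rewrite (_ : _ \o _ = fun w => r * X i w)%R; last first.
  by apply/funext => w /=; rewrite tnth_mktuple.
apply: measurable_funM => //; apply: measurable_coord; exact: Qn.
Qed.

Lemma measurableT_scaled_tuple X n r :
  measurable_fun [set: T] (scaled_tuple X n r).
Proof.
apply: (measurableT_comp (@measurable_scaled_tuple X predT n r _)) => //.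
exact: measurable_id_coordT.
Qed.

HB.instance Definition _ X n r := isMeasurableFun.Build _ _ _ _
  (scaled_tuple X n r) (@measurableT_scaled_tuple X n r).

Definition tuple_box n : set (set (n.-tuple R)) := [set A | exists B,
  (forall i, measurable (B i)) /\ A = [set s | forall i : 'I_n, B i (tnth s i)]].

Lemma measurable_tuple_box n (A : set (n.-tuple R)) :
  measurable A -> <<s @tuple_box n >> A.
Proof.
move=> mA; pose GT := g_sigma_algebraType (@tuple_box n).
suff mid : measurable_fun [set: GT] (id : GT -> n.-tuple R).
  by have := mid measurableT _ mA; rewrite setTI.
apply/measurable_fun_tnthP => i _ C mC; rewrite setTI.
apply: sub_sigma_algebra; exists (fun j => if j == i then C else setT); split.
  by move=> j; case: ifP.
apply/seteqP; split=> s /=; last by move=> /(_ i); rewrite eqxx.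
by move=> Cs j; case: eqP => // ->.
Qed.

Lemma tuple_box_measurable n : @tuple_box n `<=` measurable.
Proof.
move=> _ [B [mB ->]].
rewrite (_ : [set s | _] = \bigcap_(i in [set: 'I_n]) (@tnth n R ^~ i) @^-1` B i).
  apply: fin_bigcap_measurable => // i _; rewrite -[X in measurable X]setTI.
  exact: measurable_tnth.
by apply/seteqP; split=> [s sB i _|s sB i]; [exact: sB|exact: (sB i I)].
Qed.

(** [X] and [Y] live on the same space and may share variables; only the law of the n-tuple counts,
    and boxes determine it. *)
Lemma ge0_integral_tuple_law X Y n (g : n.-tuple R -> \bar R) :
  iid_std_exponential X -> iid_std_exponential Y ->
  measurable_fun [set: n.-tuple R] g -> (forall s, 0 <= g s) ->
  \int[P]_w g (scaled_tuple X n 1%R w) = \int[P]_w g (scaled_tuple Y n 1%R w).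
Proof.
move=> iidX iidY mg g0.
transitivity (\int[distribution P (scaled_tuple X n 1%R)]_s g s).
  by rewrite ge0_integral_distribution.
transitivity (\int[distribution P (scaled_tuple Y n 1%R)]_s g s); last first.
  by rewrite ge0_integral_distribution.
apply: eq_measure_integral => A mA _.
have boxP Z : iid_std_exponential Z -> forall B, (forall i, measurable (B i)) ->
    P (scaled_tuple Z n 1%R @^-1` [set s | forall i : 'I_n, B i (tnth s i)]) =
    \prod_(i < n) exponential_prob 1%R (B i).
  move=> [indZ expZ] B mB.
  pose C k := if insub k is Some i then B i else [set: R].
  have Ci (i : 'I_n) : C i = B i by rewrite /C valK.
  have mC k : measurable (C k) by rewrite /C; case: insub.
  have CT k : (n <= k)%N -> C k = setT.
    by move=> nk; rewrite /C insubF// ltnNge nk.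
  transitivity (P (\bigcap_(k in [set k | xpredT k]) Z k @^-1` C k)).
    congr (P _); apply/seteqP; split=> w /= Bw k.
      move=> _ /=; have [nk|kn] := leqP n k; first by rewrite CT.
      by have := Bw (Ordinal kn); rewrite tnth_mktuple mul1r -Ci.
    by rewrite tnth_mktuple mul1r -Ci; exact: Bw.
  rewrite (cylinder_probability indZ _ mC CT); apply: eq_bigr => i _.
  by rewrite Ci; exact: expZ.
apply: (@g_sigma_algebra_measure_unique _ _ _ (@tuple_box n) _ (fun=> setT)).
- exact: tuple_box_measurable.
- move=> _; exists (fun=> setT); split => //.
  by apply/seteqP; split.
- by rewrite bigcup_const//; exists 0%N.
- move=> _ _ [B [mB ->]] [C [mC ->]]; exists (fun i => B i `&` C i); split.
    by move=> i; exact: measurableI.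
  by apply/seteqP; split=> [s [Bs Cs] i|s BCs]; split => // i; case: (BCs i).
- by move=> _ [B [mB ->]]; rewrite /= /distribution /pushforward !boxP.
- by move=> _; rewrite /= probability_setT ltry.
- exact: measurable_tuple_box.
Qed.

(** The weight e^(sum) turns the law of the n-tuple into Lebesgue measure on the orthant; this is
    its homogeneity of degree n, obtained one coordinate at a time. *)
Lemma ge0_integral_tuple_scale X n (t : R) (g : n.-tuple R -> \bar R) :
  (0 < t)%R -> iid_std_exponential X ->
  measurable_fun [set: n.-tuple R] g -> (forall s, 0 <= g s) ->
  \int[P]_w ((expR (\sum_(i < n) X i w))%:E * g (scaled_tuple X n t^-1 w)) =
  (t ^+ n)%:E *
  \int[P]_w ((expR (\sum_(i < n) X i w))%:E * g (scaled_tuple X n 1%R w)).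
Proof.
move=> t0; elim: n => [|n IH] in X g *.
  move=> _ _ _; rewrite expr0 mul1e; apply: eq_integral => w _.
  by rewrite (tuple0 (scaled_tuple X 0 1%R w)) (tuple0 (scaled_tuple X 0 _ w)).
move=> iidX mg g0; have [indX expX] := iidX.
pose Y i := X i.+1.
have iidY : iid_std_exponential Y by apply: iid_std_exponential_comp => // ? ? [].
(* [c] collects the powers of [t] already extracted, [r] scales the first coordinate and [q] the
   others; the two components of [u] serve the two independent blocks. *)
pose F (c r q : R) (u : T * T) := (c * expR (X 0%N u.1))%:E *
  ((expR (\sum_(i < n) Y i u.2))%:E *
   g [tuple of (r * X 0%N u.1)%R :: scaled_tuple Y n q u.2]).
pose Q : pred nat := fun k => k == 0%N.
pose Q' : pred nat := fun k => k != 0%N.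
have F0 c r q u : (0 <= c)%R -> 0 <= F c r q u.
  by move=> c0; rewrite !mule_ge0// lee_fin ?mulr_ge0// expR_ge0.
have m0 : measurable_fun [set: coordT X Q] (X 0%N : coordT X Q -> R).
  exact: measurable_coord.
have mY q : measurable_fun [set: coordT X Q']
    (scaled_tuple Y n q : coordT X Q' -> _).
  apply/measurable_fun_tnthP => i.
  rewrite (_ : _ \o _ = fun w => q * X i.+1 w)%R; last first.
    by apply/funext => w /=; rewrite tnth_mktuple.
  by apply: measurable_funM => //; exact: measurable_coord.
have mS : measurable_fun [set: coordT X Q']
    (fun w => expR (\sum_(i < n) Y i w) : R).
  apply: measurableT_comp => //; apply: measurable_sum => i.
  exact: measurable_coord.
have mF c r q : measurable_fun [set: coordT X Q * coordT X Q']
    (F c r q : coordT X Q * coordT X Q' -> \bar R).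
  apply: emeasurable_funM.
    apply/measurable_EFinP; apply: measurable_funM => //.
    apply: measurableT_comp => //; exact: (measurableT_comp m0).
  apply: emeasurable_funM.
    by apply/measurable_EFinP; exact: (measurableT_comp mS).
  apply: (measurableT_comp mg); apply: measurable_cons.
    by apply: measurable_funM => //; exact: (measurableT_comp m0).
  exact: (measurableT_comp (mY q)).
have mF' c r q : measurable_fun [set: coordT X Q' * coordT X Q]
    ((fun u => F c r q (u.2, u.1)) : coordT X Q' * coordT X Q -> \bar R).
  by apply: (measurableT_comp (mF c r q)); exact: measurable_swap.
have QQ' k : Q k -> ~~ Q' k by rewrite /Q' negbK.
have Q'Q k : Q' k -> ~~ Q k by [].
have FE r : \int[P]_w ((expR (\sum_(i < n.+1) X i w))%:E *
    g (scaled_tuple X n.+1 r w)) = \int[P]_w F 1%R r r (w, w).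
  apply: eq_integral => w _; rewrite /F big_ord_recl/= expRD EFinM muleA mul1r.
  congr (_ * g _); apply: eq_from_tnth => i.
  have [->|[j ->]] : i = ord0 \/ exists j, i = lift ord0 j.
  - case: (unliftP ord0 i) => [j ->|->]; [by right; exists j|by left].
  - by rewrite tnth_mktuple.
  - by rewrite tnth_mktuple tnthS tnth_mktuple.
have E1 c r q : (0 <= c)%R ->
    \int[P]_w F c r q (w, w) = \int[P]_w \int[P]_w' F c r q (w, w').
  by move=> c0; apply: (ge0_integral_indep indX QQ') => // u; exact: F0.
have E2 c r q : (0 <= c)%R ->
    \int[P]_w F c r q (w, w) = \int[P]_w' \int[P]_w F c r q (w, w').
  by move=> c0; apply: (ge0_integral_indep indX Q'Q (mF' c r q)) => u; exact: F0.
have mid (Q1 : pred nat) : measurable_fun [set: T] (id : T -> coordT X Q1).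
  exact: measurable_id_coordT.
have mST : measurable_fun [set: T] (fun w => (expR (\sum_(i < n) Y i w))%:E).
  by apply/measurable_EFinP; exact: (measurableT_comp mS (mid Q')).
have mYT q : measurable_fun [set: T] (scaled_tuple Y n q).
  exact: (measurableT_comp (mY q) (mid Q')).
have tn0 : (0 <= t ^+ n)%R by rewrite exprn_ge0// ltW.
have tV (x : R) : measurable_fun [set: n.-tuple R]
    (fun s => g [tuple of x :: s] : \bar R).
  by apply: (measurableT_comp mg); exact: measurable_cons.
have tH (s : n.-tuple R) : measurable_fun [set: R]
    (fun x => g [tuple of x :: s] : \bar R).
  by apply: (measurableT_comp mg); exact: measurable_cons.
(* With the first coordinate frozen, the induction hypothesis rescales the others; after that, with
   the others frozen, the first one is rescaled. *)
rewrite !FE; transitivity (\int[P]_w F (t ^+ n)%R (t^-1)%R 1%R (w, w)).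
  apply: (etrans (E1 _ _ _ ler01)); apply: (etrans _ (esym (E1 _ _ _ tn0))).
  apply: eq_integral => w _; rewrite /F /=.
  rewrite [LHS]ge0_integralZl//; last 2 first.
  - by apply: emeasurable_funM => //; exact: (measurableT_comp (tV _)).
  - by move=> w' _; rewrite mule_ge0// lee_fin expR_ge0.
  rewrite [RHS]ge0_integralZl//; last 3 first.
  - by apply: emeasurable_funM => //; exact: (measurableT_comp (tV _)).
  - by move=> w' _; rewrite mule_ge0// lee_fin expR_ge0.
  - by rewrite lee_fin mulr_ge0// expR_ge0.
  rewrite mul1r (mulrC (t ^+ n)%R) EFinM -muleA; congr (_ * _).
  exact: (IH Y (fun s => g [tuple of (t^-1 * X 0%N w)%R :: s])).
transitivity (\int[P]_w F (t ^+ n.+1)%R 1%R 1%R (w, w)).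
  have tn10 : (0 <= t ^+ n.+1)%R by rewrite exprn_ge0// ltW.
  apply: (etrans (E2 _ _ _ tn0)); apply: (etrans _ (esym (E2 _ _ _ tn10))).
  apply: eq_integral => w' _; rewrite /F /=.
  pose h x := (t ^+ n)%:E * ((expR (\sum_(i < n) Y i w'))%:E *
    g [tuple of x :: scaled_tuple Y n 1 w']).
  have mh : measurable_fun [set: R] h.
    by apply: emeasurable_funM => //; exact: emeasurable_funM.
  have h0 x : 0 <= h x by rewrite !mule_ge0 ?lee_fin// expR_ge0.
  transitivity (\int[P]_w ((expR (X 0%N w))%:E * h (t^-1 * X 0%N w)%R)).
    by apply: eq_integral => w _; rewrite /h (mulrC (t ^+ n)%R) EFinM -muleA.
  rewrite (std_exponential_scale (expX 0%N))//.
  rewrite -ge0_integralZl//; last 3 first.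
  - apply: emeasurable_funM; last by apply: (measurableT_comp mh).
    by apply/measurable_EFinP; exact: measurableT_comp.
  - by move=> w _; rewrite mule_ge0// lee_fin expR_ge0.
  - by rewrite lee_fin ltW.
  apply: eq_integral => w _; rewrite /h mul1r !muleA -!EFinM exprS.
  by congr (_%:E * _); ring.
rewrite -ge0_integralZl//; last 3 first.
- apply: (measurableT_comp (mF 1%R 1%R 1%R)).
  by apply/measurable_fun_pair; exact: mid.
- by move=> w _; exact: F0.
- by rewrite lee_fin exprn_ge0// ltW.
by apply: eq_integral => w _; rewrite /F (mul1r (expR _)) EFinM -!muleA.
Qed.

End tuple_law.

(** * Contacts with the convex minorant *)

Section deterministic_walk.
Context (R : realType) (t : R).
Implicit Types x z : nat -> R.

Definition drift k x : R := \sum_(j < k) (x j - t).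

Definition iwalk k x : R := \sum_(i < k) drift i.+1 x.

(* [slack n x] is the least [c >= 0] such that the line of slope [- c]
   supports from below, on n steps, the path with second differences
   [x k - t] that starts with a horizontal step. *)
Definition slack n x : R :=
  \big[Num.max/0]_(k < n) (- iwalk k x / k.+1%:R).

Lemma iwalkS k x : iwalk k.+1 x = iwalk k x + drift k.+1 x.
Proof. by rewrite /iwalk big_ord_recr. Qed.

Lemma driftS k x : drift k.+1 x = drift k x + (x k - t).
Proof. by rewrite /drift big_ord_recr. Qed.

Lemma iwalk0 x : iwalk 0 x = 0. Proof. by rewrite /iwalk big_ord0. Qed.

Lemma drift0 x : drift 0 x = 0. Proof. by rewrite /drift big_ord0. Qed.

Lemma slack_ge0 n x : 0 <= slack n x.
Proof. by rewrite /slack; apply: bigmax_ge_id. Qed.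

Lemma slack_leP n x c : (0 < n)%N ->
  slack n x <= c <-> forall k, (k < n)%N -> 0 <= k.+1%:R * c + iwalk k x.
Proof.
move=> n0; split=> [/bigmax_leP[c0 sc] k kn|sc].
  have := sc (Ordinal kn) isT; rewrite /= ler_pdivrMr// mulrC; lra.
apply/bigmax_leP; split=> [|k _]; first by have := sc 0%N n0; rewrite iwalk0 mul1r addr0.
by rewrite ler_pdivrMr// mulrC; have := sc k (ltn_ord k); lra.
Qed.

(** A path is determined by its first value, its first step and its second differences. This is
    applied to the path read forwards and backwards from a given time. *)
Lemma second_difference_iwalk n (Z : nat -> R) x :
  (forall k, (k.+1 < n)%N -> Z k.+2 - Z k.+1 = Z k.+1 - Z k + (x k - t)) ->
  forall k, (k < n)%N ->
  Z k.+1 - Z k = (Z 1%N - Z 0%N) + drift k x /\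
  Z k.+1 = Z 0%N + k.+1%:R * (Z 1%N - Z 0%N) + iwalk k x.
Proof.
move=> ZE; elim=> [|k IH] kn; first by rewrite drift0 iwalk0; split; lra.
have [IH1 IH2] := IH (ltnW kn).
have E1 : Z k.+2 - Z k.+1 = Z 1%N - Z 0%N + drift k.+1 x.
  rewrite ZE// IH1 driftS; ring.
split=> //; rewrite iwalkS; have -> : Z k.+2 = Z k.+1 + (Z k.+2 - Z k.+1) by ring.
rewrite E1 IH2 -[in k.+2%:R]addn1 natrD; ring.
Qed.

(** Both [before] and [after] skip [x i], so that the kink at time i stays independent of the path
    on either side. [before] runs backwards in time, which leaves second differences unchanged. *)
Definition before i x k := x (i.-1 - k)%N.
Definition after i x k := x (i.+1 + k)%N.

Lemma iwalk_second_difference x i :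
  iwalk i.+2 x - iwalk i.+1 x = iwalk i.+1 x - iwalk i x + (x i.+1 - t).
Proof. by rewrite 2!iwalkS (driftS i.+1); ring. Qed.

Lemma iwalk_after x i k :
  iwalk (i + k.+1) x - iwalk (i + k) x =
    iwalk i.+1 x - iwalk i x + drift k (after i x) /\
  iwalk (i + k.+1) x =
    iwalk i x + k.+1%:R * (iwalk i.+1 x - iwalk i x) + iwalk k (after i x).
Proof.
have := @second_difference_iwalk k.+1 (fun k => iwalk (i + k) x) (after i x) _ k (ltnSn k).
rewrite addn0 addn1; apply=> j _.
by rewrite !addnS iwalk_second_difference /after addSn.
Qed.

Lemma iwalk_before x i k : (k < i)%N ->
  iwalk (i - k.+1) x =
    iwalk i x + k.+1%:R * (iwalk i.-1 x - iwalk i x) + iwalk k (before i x).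
Proof.
move=> ki; have := @second_difference_iwalk i (fun k => iwalk (i - k) x) (before i x) _ k ki.
rewrite subn0 subn1 => H; apply H => j ji.
have -> : (i - j = (i - j.+2).+2)%N by lia.
have -> : (i - j.+1 = (i - j.+2).+1)%N by lia.
rewrite /before; have -> : (i.-1 - j = (i - j.+2).+1)%N by lia.
have := iwalk_second_difference x (i - j.+2); lra.
Qed.

Lemma slack_afterP x i n c : (0 < n)%N ->
  slack n (after i x) <= iwalk i.+1 x - iwalk i x - c <->
  forall k, (k < n)%N -> iwalk i x + c * k.+1%:R <= iwalk (i + k.+1) x.
Proof.
move=> n0; rewrite slack_leP//.
by split=> H k /H; have [_ ->] := iwalk_after x i k; rewrite mulrBr; lra.
Qed.

Lemma slack_beforeP x i c : (0 < i)%N ->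
  slack i (before i x) <= c - (iwalk i x - iwalk i.-1 x) <->
  forall k, (k < i)%N -> iwalk i x - c * k.+1%:R <= iwalk (i - k.+1) x.
Proof.
move=> i0; rewrite slack_leP//.
by split=> H k /[dup] ki /H; rewrite iwalk_before// !mulrBr; lra.
Qed.

(* [i] is a contact when the point (i, iwalk i x) lies on the convex minorant
   of the path a |-> iwalk a x on [0, N]. *)
Definition contact N x i : bool :=
  slack i (before i x) + slack (N - i) (after i x) <= x i - t.

Definition support N x i c := forall a, (a <= N)%N ->
  iwalk i x + c * (a%:R - i%:R) <= iwalk a x.

Lemma supportP N x i c : (0 < i < N)%N ->
  support N x i c <->
  slack i (before i x) <= c - (iwalk i x - iwalk i.-1 x) /\
  slack (N - i) (after i x) <= iwalk i.+1 x - iwalk i x - c.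
Proof.
move=> /andP[i0 iN]; rewrite slack_beforeP// slack_afterP ?subn_gt0//.
split=> [sup|[supl supr] a aN].
  split=> k ki.
    by have := sup (i - k.+1)%N ltac:(lia); rewrite natrB//; lra.
  by have := sup (i + k.+1)%N ltac:(lia); rewrite natrD; lra.
have [ai|ia|->] := ltngtP a i; last by lra.
  have := supl (i - a.+1)%N ltac:(lia).
  have -> : (i - a.+1).+1 = (i - a)%N by lia.
  by rewrite subKn ?(ltnW ai)// natrB ?(ltnW ai)//; lra.
have := supr (a - i.+1)%N ltac:(lia).
have -> : (a - i.+1).+1 = (a - i)%N by lia.
by rewrite subnKC ?(ltnW ia)// natrB ?(ltnW ia)//; lra.
Qed.

(** A supporting slope must exceed the step before i by at least the left slack, and stay below the
    step after i by at least the right slack. There is room for it exactly when the kink [x i - t]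
    is at least the sum of the two. *)
Lemma contactP N x i : (0 < i < N)%N ->
  contact N x i <-> exists c, support N x i c.
Proof.
move=> iN; have i0 : (0 < i)%N by case/andP: iN.
have sd : iwalk i.+1 x - iwalk i x = iwalk i x - iwalk i.-1 x + (x i - t).
  by have := iwalk_second_difference x i.-1; rewrite prednK.
rewrite /contact; split=> [ci|[c /(supportP _ _ iN)[]]]; last by lra.
(* The smallest slope that the left side allows. *)
exists (iwalk i x - iwalk i.-1 x + slack i (before i x)).
by apply/(supportP _ _ iN); split; lra.
Qed.

End deterministic_walk.

(** * Consecutive contacts and the path above their chord *)

Section bridges.
Context (R : realType) (t : R).
Implicit Types x z : nat -> R.
Local Notation iwalk := (iwalk t).

(* [bridge m z]: the path with second differences [z k - t] pinned at 0 at
   times 0 and [m] is positive in between; it leaves 0 with slope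
   [start_slope m z] and returns with slope [end_slope m z]. *)
Definition start_slope m z : R := - iwalk m.-1 z / m%:R.
Definition end_slope m z : R := start_slope m z + drift t m.-1 z.
Definition bridge m z : bool :=
  [forall k : 'I_m.-1, 0 < k.+1%:R * start_slope m z + iwalk k z].

Lemma bridgeP m z : bridge m z <->
  forall k, (k < m.-1)%N -> 0 < k.+1%:R * start_slope m z + iwalk k z.
Proof.
split=> [/forallP br k km|br]; first exact: (br (Ordinal km)).
by apply/forallP => k; exact: br.
Qed.

Lemma start_slopeE m z : (0 < m)%N -> m%:R * start_slope m z = - iwalk m.-1 z.
Proof. by move=> m0; rewrite /start_slope mulrC divfK// pnatr_eq0 -lt0n. Qed.

(** A path that is positive between two zeros leaves upwards and returns downwards. These signs make
    the thresholds of [contact_pair] nonnegative, as lack of memory requires. *)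
Lemma bridge_slopes m z : (0 < m)%N -> bridge m z ->
  0 <= start_slope m z /\ end_slope m z <= 0.
Proof.
case: m => // -[|m] _ /bridgeP br.
  by rewrite /end_slope /start_slope /= iwalk0 drift0 oppr0 mul0r addr0.
split; first by have := br 0%N isT; rewrite iwalk0 mul1r addr0 => /ltW.
have := br m (ltnSn m); have := @start_slopeE m.+2 z isT.
rewrite /end_slope /= iwalkS -[in m.+2%:R]addn1 natrD; lra.
Qed.

Definition chord x i j := (iwalk j x - iwalk i x) / (j - i)%:R.

Lemma chordE x i j : (i < j)%N ->
  iwalk j x = iwalk i x + chord x i j * (j%:R - i%:R).
Proof.
move=> ij; rewrite /chord natrB ?(ltnW ij)// divfK; first by ring.
by rewrite subr_eq0 eqr_nat gtn_eqF.
Qed.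

Lemma chord_slopes x i j : (i < j)%N ->
  iwalk i.+1 x - iwalk i x = chord x i j + start_slope (j - i) (after i x) /\
  iwalk j x - iwalk j.-1 x = chord x i j + end_slope (j - i) (after i x).
Proof.
move=> ij; pose m := (j - i).-1; have mE : (j - i)%N = m.+1 by rewrite /m; lia.
have jE : j = (i + m.+1)%N by lia.
have [D W] := iwalk_after t x i m.
have S : iwalk i.+1 x - iwalk i x = chord x i j + start_slope m.+1 (after i x).
  rewrite /chord mE {1}jE W /start_slope /=; field.
  by rewrite addrC natr1 pnatr_eq0.
rewrite mE; split=> //.
have -> : j.-1 = (i + m)%N by lia.
by rewrite /end_slope /= addrA -S -D jE.
Qed.

Definition above_chord x i j := forall a, (i < a < j)%N ->
  iwalk i x + chord x i j * (a%:R - i%:R) < iwalk a x.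

Lemma above_chordP x i j : (i < j)%N ->
  bridge (j - i) (after i x) <-> above_chord x i j.
Proof.
move=> ij; have [S _] := chord_slopes x ij; rewrite bridgeP.
split=> H.
  move=> a /andP[ia aj]; have := H (a - i.+1)%N ltac:(lia).
  have [_] := iwalk_after t x i (a - i.+1).
  have -> : (i + (a - i.+1).+1 = a)%N by lia.
  have -> : (a - i.+1).+1 = (a - i)%N by lia.
  by rewrite S natrB ?(ltnW ia)//; lra.
move=> k km; have := H (i + k.+1)%N ltac:(lia).
have [_ ->] := iwalk_after t x i k.
by rewrite S natrD; lra.
Qed.

(** The path is strictly above the chord in between, and the line of the chord supports it on both
    sides. In this form [x i] and [x j] are bounded below by quantities that involve neither of
    them. *)
Definition contact_pair N x i j : bool :=
  [&& bridge (j - i) (after i x),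
      t + start_slope (j - i) (after i x) + slack t i (before i x) <= x i &
      t - end_slope (j - i) (after i x) + slack t (N - j) (after j x) <= x j].

Lemma contact_pair_supportP N x i j : (0 < i < j)%N -> (j < N)%N ->
  contact_pair N x i j <->
  above_chord x i j /\ (forall a, (a <= N)%N -> (a <= i)%N || (j <= a)%N ->
    iwalk i x + chord x i j * (a%:R - i%:R) <= iwalk a x).
Proof.
move=> /andP[i0 ij] jN; have j0 : (0 < j)%N by lia.
have [S E] := chord_slopes x ij.
have Cj := chordE x ij.
have sdi : iwalk i.+1 x - iwalk i x = iwalk i x - iwalk i.-1 x + (x i - t).
  by have := iwalk_second_difference t x i.-1; rewrite prednK.
have sdj : iwalk j.+1 x - iwalk j x = iwalk j x - iwalk j.-1 x + (x j - t).
  by have := iwalk_second_difference t x j.-1; rewrite prednK.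
have HL := slack_beforeP t x (chord x i j) i0.
have HR := @slack_afterP _ t x j (N - j) (chord x i j) ltac:(lia).
have -> : contact_pair N x i j <-> bridge (j - i) (after i x) /\
    slack t i (before i x) <= chord x i j - (iwalk i x - iwalk i.-1 x) /\
    slack t (N - j) (after j x) <= iwalk j.+1 x - iwalk j x - chord x i j.
  split=> [/and3P[br H1 H2]|[br [H1 H2]]]; first by split=> //; split; lra.
  by apply/and3P; split=> //; lra.
rewrite above_chordP// HL HR; split=> [[A [B C]]|[A B]]; split=> //.
  move=> a aN /orP[ai|ja].
    have [->|ai'] := eqVneq a i; first by lra.
    have := B (i - a.+1)%N ltac:(lia).
    have -> : (i - a.+1).+1 = (i - a)%N by lia.
    by rewrite subKn// natrB//; lra.
  have [->|aj'] := eqVneq a j; first by lra.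
  have := C (a - j.+1)%N ltac:(lia).
  have -> : (a - j.+1).+1 = (a - j)%N by lia.
  by rewrite subnKC// natrB//; lra.
split=> k ki.
  by have := B (i - k.+1)%N ltac:(lia) ltac:(lia); rewrite natrB//; lra.
by have := B (j + k.+1)%N ltac:(lia) ltac:(lia); rewrite natrD; lra.
Qed.

(* If some interior point were on or below the chord, the point furthest
   below it would be a contact. *)
Lemma no_contact_above_chord N x i j : (i < j <= N)%N ->
  (forall a, (a <= N)%N -> (a <= i)%N || (j <= a)%N ->
    iwalk i x + chord x i j * (a%:R - i%:R) <= iwalk a x) ->
  (forall k, (i < k < j)%N -> ~~ contact t N x k) -> above_chord x i j.
Proof.
move=> /andP[ij jN] out noc a0 a0ij; apply: contraT; rewrite -leNgt => a0le.
pose D a := iwalk a x - (iwalk i x + chord x i j * (a%:R - i%:R)).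
have a0N : (a0 < N.+1)%N by lia.
have [k kij kmin] := @arg_minP _ _ 'I_N.+1 (Ordinal a0N)
  (fun a => i < a < j)%N (fun a => D a) a0ij.
have kN : (0 < k < N)%N by lia.
suff : contact t N x k by rewrite (negbTE (noc _ kij)).
apply/contactP => //; exists (chord x i j) => a aN.
have Dk0 : D k <= 0 by have := kmin (Ordinal a0N) a0ij; rewrite /D /=; lra.
have : D k <= D a.
  have [aij|] := boolP (i < a < j)%N.
    have aN' : (a < N.+1)%N by []; exact: (kmin (Ordinal aN')).
  rewrite negb_and -!leqNgt => /(out a aN); rewrite /D in Dk0 *; lra.
rewrite /D; lra.
Qed.

(** A contact strictly inside would carry a line that starts above the chord and passes below both
    of its ends, which is impossible. Conversely, the supporting slopes at i and j enclose the slope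
    of the chord, so its line lies below the path outside [i, j], and [no_contact_above_chord]
    treats the inside. *)
Lemma contact_pairP N x i j : (0 < i < j)%N -> (j < N)%N ->
  contact_pair N x i j <->
  [/\ contact t N x i, contact t N x j &
      forall k, (i < k < j)%N -> ~~ contact t N x k].
Proof.
move=> ij jN; have ij' : (i < j)%N by case/andP: ij.
have Cj := chordE x ij'.
have iN : (0 < i < N)%N by lia.
have jN' : (0 < j < N)%N by lia.
rewrite contact_pair_supportP//; split=> [[ab out]|[/(contactP _ _ iN)[ci si] ]].
  have supi : support t N x i (chord x i j).
    move=> a aN; have [aij|] := boolP (i < a < j)%N; first exact/ltW/ab.
    by rewrite negb_and -!leqNgt; exact: out.
  split.
  - by apply/contactP => //; exists (chord x i j).
  - apply/contactP => //; exists (chord x i j) => a /supi; rewrite Cj; lra.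
  - move=> k kij; apply/negP => /contactP[]; first by lia.
    move=> c sk; have := ab k kij; have := sk i ltac:(lia); have := sk j ltac:(lia).
    rewrite Cj.
    have /andP[ik kj] := kij.
    have : (0 : R) < k%:R - i%:R by rewrite subr_gt0 ltr_nat.
    have : (0 : R) < j%:R - k%:R by rewrite subr_gt0 ltr_nat.
    nra.
move=> /(contactP _ _ jN')[cj sj] noc.
have ji0 : (0 : R) < j%:R - i%:R by rewrite subr_gt0 ltr_nat.
have out a : (a <= N)%N -> (a <= i)%N || (j <= a)%N ->
    iwalk i x + chord x i j * (a%:R - i%:R) <= iwalk a x.
  move=> aN /orP[ai|ja].
    have cic : ci <= chord x i j.
      by have := si j ltac:(lia); rewrite Cj; nra.
    have : a%:R <= i%:R :> R by rewrite ler_nat.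
    have := si a aN; nra.
  have cjc : chord x i j <= cj.
    by have := sj i ltac:(lia); rewrite Cj; nra.
  have : j%:R <= a%:R :> R by rewrite ler_nat.
  have := sj a aN; rewrite Cj; nra.
split=> //; apply: (@no_contact_above_chord N) => //; lia.
Qed.

(** Without interior contacts the convex minorant on [0, N] is a single chord. *)
Lemma no_contact_bridge N x : (0 < N)%N ->
  (forall k, (0 < k < N)%N -> ~~ contact t N x k) -> bridge N (after 0 x).
Proof.
move=> N0 noc; rewrite -[X in bridge X]subn0; apply/above_chordP => //.
apply: (@no_contact_above_chord N) => //; first by rewrite N0 leqnn.
move=> a aN; rewrite leqn0 => /orP[/eqP->|Na]; first by lra.
have -> : a = N by lia.
by rewrite -chordE.
Qed.

End bridges.

(** * Counting pairs of consecutive elements *)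

Section count.

Lemma index_iota_rcons i n : (i <= n)%N ->
  index_iota i n.+1 = rcons (index_iota i n) n.
Proof. by move=> i_n; rewrite /index_iota subSn// -addn1 iotaD cats1 subnKC. Qed.

(** A nonempty finite set has exactly one last element. *)
Lemma count_last (K : pred nat) n : (0 < n)%N ->
  (\sum_(1 <= i < n) (K i && ~~ has K (index_iota i.+1 n)) =
   has K (index_iota 1 n))%N.
Proof.
elim: n => [//|[_ _|n IH _]]; first by rewrite big_geq.
rewrite big_nat_recr// (@index_iota_rcons 1 n.+1 isT) has_rcons.
rewrite [index_iota n.+2 _]/index_iota subnn [has K (iota _ 0)]/= [~~ false]/= andbT.
have [Kn|Kn] := boolP (K n.+1).
  rewrite big_nat big1 ?add0n// => i /andP[i1 i_n].
  by rewrite index_iota_rcons// has_rcons Kn andbF.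
apply: etrans (addn0 _) _; rewrite -[RHS]/(nat_of_bool (has K _)) -IH//.
apply: eq_big_nat => i /andP[i1 i_n].
by rewrite index_iota_rcons// has_rcons (negbTE Kn).
Qed.

(** Each element except the first closes exactly one pair, with its predecessor; the indicator of
    emptiness corrects the case where there is no first element. *)
Lemma count_consecutive (K : pred nat) n : (0 < n)%N ->
  (1 + \sum_(1 <= j < n) \sum_(1 <= i < j)
     [&& K i, K j & ~~ has K (index_iota i.+1 j)] =
   ~~ has K (index_iota 1 n) + \sum_(1 <= j < n) K j)%N.
Proof.
elim: n => [//|[_ _|n IH _]]; first by rewrite !big_geq.
have -> : has K (index_iota 1 n.+2) = K n.+1 || has K (index_iota 1 n.+1).
  by rewrite index_iota_rcons// has_rcons.
rewrite !(@big_nat_recr _ _ _ n.+1 1)//= addnA IH//.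
have -> : (\sum_(1 <= i < n.+1)
    [&& K i, K n.+1 & ~~ has K (index_iota i.+1 n.+1)] =
    K n.+1 && has K (index_iota 1 n.+1))%N.
  have [Kn|Kn] := boolP (K n.+1); last by rewrite big1// => i _; rewrite andbF.
  by rewrite -count_last.
by case: (K n.+1); case: (has _ _) => /=; lia.
Qed.

End count.

(** * Contact probabilities *)

Section measurability.
Context (R : realType) (t : R) d (S : measurableType d).
Variable y : nat -> S -> R.

(** The family [y] and the space are arbitrary here, since the same facts are wanted on the sample
    space, on [coordT] and on tuples. *)
Lemma measurable_drift n : (forall j, (j < n)%N -> measurable_fun [set: S] (y j)) ->
  measurable_fun [set: S] (fun s => drift t n (y^~ s)).
Proof.
move=> my; apply: measurable_sum => j; apply: measurable_funB => //; exact: my.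
Qed.

Lemma measurable_iwalk n : (forall j, (j < n)%N -> measurable_fun [set: S] (y j)) ->
  measurable_fun [set: S] (fun s => iwalk t n (y^~ s)).
Proof.
move=> my; apply: measurable_sum => i; apply: measurable_drift => j ji.
by apply: my; exact: leq_trans ji (ltn_ord i).
Qed.

Lemma measurable_slack n : (forall j, (j.+1 < n)%N -> measurable_fun [set: S] (y j)) ->
  measurable_fun [set: S] (fun s => slack t n (y^~ s)).
Proof.
move=> my; rewrite /slack.
suff mbig : forall m (F : nat -> S -> R),
    (forall k, (k < m)%N -> measurable_fun [set: S] (F k)) ->
    measurable_fun [set: S] (fun s => \big[Num.max/0]_(k < m) F k s).
  apply: (mbig n (fun k s => - iwalk t k (y^~ s) / k.+1%:R)) => k kn.
  apply: measurable_funM => //; apply: measurable_funN.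
  by apply: measurable_iwalk => j jm; apply: my; exact: leq_trans kn.
elim=> [F _|m IH F mF].
  rewrite (_ : (fun s => \big[Num.max/0]_(k < 0) F k s) = cst 0).
    exact: measurable_cst.
  by apply/funext => s; rewrite big_ord0.
rewrite (_ : (fun s => \big[Num.max/0]_(k < m.+1) F k s) =
  (fun s => Num.max (F 0%N s) (\big[Num.max/0]_(k < m) F k.+1 s))).
  by apply: measurable_maxr; [exact: mF|apply: (IH (fun k => F k.+1)) => k km; exact: mF].
by apply/funext => s; rewrite big_ord_recl.
Qed.

Lemma measurable_start_slope n :
  (forall j, (j.+1 < n)%N -> measurable_fun [set: S] (y j)) ->
  measurable_fun [set: S] (fun s => start_slope t n (y^~ s)).
Proof.
move=> my; apply: measurable_funM => //; apply: measurable_funN.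
by apply: measurable_iwalk => j jn; apply: my; lia.
Qed.

Lemma measurable_end_slope n :
  (forall j, (j.+1 < n)%N -> measurable_fun [set: S] (y j)) ->
  measurable_fun [set: S] (fun s => end_slope t n (y^~ s)).
Proof.
move=> my; apply: measurable_funD; first exact: measurable_start_slope.
by apply: measurable_drift => j jn; apply: my; lia.
Qed.

Lemma measurable_le_set (f g : S -> R) : measurable_fun [set: S] f ->
  measurable_fun [set: S] g -> measurable [set s | f s <= g s].
Proof.
move=> mf mg; have := measurable_fun_ler mf mg.
by move=> /(_ measurableT [set true] I); rewrite setTI.
Qed.

Lemma measurable_lt_set (f g : S -> R) : measurable_fun [set: S] f ->
  measurable_fun [set: S] g -> measurable [set s | f s < g s].
Proof.
move=> mf mg; have := measurable_fun_ltr mf mg.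
by move=> /(_ measurableT [set true] I); rewrite setTI.
Qed.

Lemma measurable_bridge n :
  (forall j, (j.+1 < n)%N -> measurable_fun [set: S] (y j)) ->
  measurable [set s | bridge t n (y^~ s)].
Proof.
move=> my; rewrite (_ : [set s | _] = \bigcap_(k in [set k | (k < n.-1)%N])
    [set s | 0 < k.+1%:R * start_slope t n (y^~ s) + iwalk t k (y^~ s)]).
  apply: bigcap_measurableType => k /= kn.
  apply: measurable_lt_set => //; apply: measurable_funD.
    by apply: measurable_funM => //; exact: measurable_start_slope.
  by apply: measurable_iwalk => j jk; apply: my; lia.
by apply/seteqP; split=> s /=; rewrite bridgeP.
Qed.

End measurability.

(** * Locality, monotonicity and scaling of path functionals *)

Section locality.
Context (R : realType) (t : R).
Implicit Types x z : nat -> R.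

Lemma eq_drift n x z : (forall j, (j < n)%N -> x j = z j) ->
  drift t n x = drift t n z.
Proof. by move=> xz; apply: eq_bigr => j _; rewrite xz. Qed.

Lemma eq_iwalk n x z : (forall j, (j < n)%N -> x j = z j) ->
  iwalk t n x = iwalk t n z.
Proof.
move=> xz; apply: eq_bigr => i _; apply: eq_drift => j ji.
by apply: xz; exact: leq_trans ji (ltn_ord i).
Qed.

Lemma eq_slack n x z : (forall j, (j.+1 < n)%N -> x j = z j) ->
  slack t n x = slack t n z.
Proof.
move=> xz; apply: eq_bigr => k _; congr (- _ / _); apply: eq_iwalk => j jk.
by apply: xz; exact: leq_trans (ltn_ord k).
Qed.

Lemma eq_bridge n x z : (forall j, (j.+1 < n)%N -> x j = z j) ->
  bridge t n x = bridge t n z.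
Proof.
move=> xz; apply: eq_forallb => k; congr (0 < _ * (- _ / _) + _).
  by apply: eq_iwalk => j jn; apply: xz; lia.
by apply: eq_iwalk => j jn; apply: xz; have := ltn_ord k; lia.
Qed.

Lemma slack_le n m x : (n <= m)%N -> slack t n x <= slack t m x.
Proof.
move=> nm; apply/bigmax_leP; split=> [|k _]; first exact: slack_ge0.
rewrite /slack; have km := leq_trans (ltn_ord k) nm.
exact: (@le_bigmax_cond _ _ _ 0 (Ordinal km) xpredT
  (fun k : 'I_m => - iwalk t k x / k.+1%:R)).
Qed.

Lemma iwalk_scale k x : t != 0 ->
  iwalk t k x = t * iwalk 1 k (fun j => t^-1 * x j).
Proof.
move=> t0; rewrite /iwalk mulr_sumr; apply: eq_bigr => i _.
by rewrite /drift mulr_sumr; apply: eq_bigr => j _; rewrite mulrBr mulrA mulfV// mul1r mulr1.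
Qed.

(** Positivity of the bridge survives multiplication of the whole path by a positive number; this is
    what removes t from the polytope of gaps. *)
Lemma bridge_scale n x : 0 < t ->
  bridge t n x = bridge 1 n (fun j => t^-1 * x j).
Proof.
move=> t0; apply: eq_forallb => k.
rewrite /start_slope !(@iwalk_scale _ x) ?gt_eqF// -mulrN -mulrA.
by rewrite mulrCA -mulrDr pmulr_rgt0.
Qed.

(** If the slopes stay above -M, the path descends by at most M per step, so a line of slope -M lies
    below it. *)
Lemma drift_ge_slack n x M : (0 < n)%N ->
  (forall i, (0 < i < n)%N -> - M <= drift t i x) -> 0 <= M -> slack t n x <= M.
Proof.
move=> n0 dM M0; apply/slack_leP => // k kn.
have : - (k%:R * M) <= iwalk t k x.
  rewrite /iwalk mulr_natl -{1}(card_ord k) -sumr_const -sumrN.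
  by apply: ler_sum => i _; apply: dM; have := ltn_ord i; lia.
rewrite -natr1 mulrDl; lra.
Qed.

End locality.

(** * Lack of memory *)

Section memoryless.
Context d (T : measurableType d) (R : realType) (P : probability T R).
Variable X : nat -> {RV P >-> R}.
Hypothesis iidX : iid_std_exponential X.
Local Open Scope ereal_scope.

(** [X i] is integrated out with the other coordinates fixed. The tail formula e^-f holds for
    nonnegative thresholds, whence the sign condition on [f] where [h] is positive. *)
Lemma integral_tail_indep (Q : pred nat) i (f h : T -> R) : ~~ Q i ->
  measurable_fun [set: coordT X Q] (f : coordT X Q -> R) ->
  measurable_fun [set: coordT X Q] (h : coordT X Q -> R) ->
  (forall w, 0 <= h w)%R -> (forall w, 0 < h w -> 0 <= f w)%R ->
  \int[P]_w (h w * \1_[set w | f w <= X i w]%R w)%:E =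
  \int[P]_w (h w * expR (- f w))%:E.
Proof.
move=> Qi mf mh h0 hf; have [indX expX] := iidX.
pose Q' : pred nat := pred1 i.
have QQ' k : Q k -> ~~ Q' k by move=> Qk; apply/eqP => ki; rewrite -ki Qk in Qi.
have mXi : measurable_fun [set: coordT X Q'] (X i : coordT X Q' -> R).
  by apply: measurable_coord; rewrite /Q' /=.
pose F (u : T * T) := (h u.1 * \1_[set u : T * T | f u.1 <= X i u.2]%R u)%:E.
have -> : \int[P]_w (h w * \1_[set w | f w <= X i w]%R w)%:E =
    \int[P]_w F (w, w).
  by apply: eq_integral => w _; rewrite /F !indicE; congr (_ * _%:R)%:E; rewrite !inE.
rewrite (@ge0_integral_indep _ _ _ _ _ indX Q Q')//; last 2 first.
- apply/measurable_EFinP; apply: measurable_funM.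
    exact: (measurableT_comp mh).
  apply: measurable_indic; apply: (@measurable_le_set R _ (coordT X Q * coordT X Q')%type).
    exact: (measurableT_comp mf).
  exact: (measurableT_comp mXi).
- by move=> u; rewrite lee_fin mulr_ge0.
apply: eq_integral => w _; rewrite /F /=.
have mA : measurable [set w' | f w <= X i w']%R by exact: measurable_le_set.
transitivity ((h w)%:E * P [set w' | f w <= X i w']%R).
  rewrite -[X in _ * P X]setIT -integral_indic// -ge0_integralZl//.
    by apply/measurable_EFinP; exact: measurable_indic.
  by rewrite lee_fin.
have [hw0|hw] := eqVneq (h w) 0%R; first by rewrite hw0 mul0e mul0r.
have hw' : (0 < h w)%R by rewrite lt_neqAle eq_sym hw h0.
by rewrite (std_exponential_tail (expX i) (hf _ hw')) EFinM.
Qed.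

Lemma probability_tail_indep (Q : pred nat) i (f : T -> R) (A : set T) :
  ~~ Q i ->
  measurable_fun [set: coordT X Q] (f : coordT X Q -> R) ->
  measurable (A : set (coordT X Q)) ->
  (forall w, A w -> 0 <= f w)%R ->
  P (A `&` [set w | f w <= X i w]%R) =
  \int[P]_w (\1_A w * expR (- f w))%:E.
Proof.
move=> Qi mf mA Af.
have mfT : measurable_fun [set: T] f.
  exact: (measurableT_comp mf (@measurable_id_coordT _ _ _ _ X Q)).
rewrite -(@integral_tail_indep Q i f (\1_A))//; last first.
  by move=> w; rewrite indicE; case: (boolP (w \in A)); rewrite ?ltxx// inE => /Af.
rewrite -[X in P X]setIT -integral_indic//; last first.
  apply: measurableI; first exact: coordT_measurable mA.
  exact: measurable_le_set.
by apply: eq_integral => w _; rewrite indicI.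
Qed.

End memoryless.

(** * Probability of a single contact *)

Section contact_probabilities.
Context d (T : measurableType d) (R : realType) (P : probability T R).
Variables (X : nat -> {RV P >-> R}) (t : R).
Hypothesis iidX : iid_std_exponential X.
Local Open Scope ereal_scope.

Local Notation Xs w := (fun k : nat => X k w).

Lemma measurable_nth_tuple n j :
  measurable_fun [set: n.-tuple R] (fun s : n.-tuple R => nth 0%R s j).
Proof.
have [nj|jn] := leqP n j.
  rewrite (_ : (fun s : n.-tuple R => nth 0%R s j) = cst 0%R).
    exact: measurable_cst.
  by apply/funext => s; rewrite nth_default// size_tuple.
rewrite (_ : (fun s : n.-tuple R => nth 0%R s j) = (@tnth n R ^~ (Ordinal jn))).
  exact: measurable_tnth.
by apply/funext => s; rewrite (tnth_nth 0%R).
Qed.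

Lemma nth_scaled_tuple (Y : nat -> {RV P >-> R}) n r w j : (j < n)%N ->
  nth 0%R (scaled_tuple Y n r w) j = (r * Y j w)%R.
Proof. by move=> jn; rewrite -(tnth_nth _ _ (Ordinal jn)) tnth_mktuple. Qed.

Lemma ge0_integral_iid_law (Y : nat -> {RV P >-> R}) n (G : (nat -> R) -> \bar R) :
  iid_std_exponential Y ->
  (forall x z, (forall j, (j < n)%N -> x j = z j) -> G x = G z) ->
  measurable_fun [set: n.-tuple R] (fun s : n.-tuple R => G (nth 0%R s)) ->
  (forall x, 0 <= G x) ->
  \int[P]_w G (fun k => Y k w) = \int[P]_w G (Xs w).
Proof.
move=> iidY locG mG G0.
have GE (Z : nat -> {RV P >-> R}) w :
    G (fun k => Z k w) = G (nth 0%R (scaled_tuple Z n 1 w)).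
  by apply: locG => j jn; rewrite nth_scaled_tuple// mul1r.
under eq_integral do rewrite GE; under [RHS]eq_integral do rewrite GE.
by rewrite (@ge0_integral_tuple_law _ _ _ _ Y X n
  (fun s : n.-tuple R => G (nth 0%R s)) iidY iidX mG).
Qed.

(* a_n, by [survival_probability]. *)
Definition escape n : \bar R := \int[P]_w (expR (- slack t n (Xs w)))%:E.

Lemma escape_ge0 n : 0 <= escape n.
Proof. by apply: integral_ge0 => w _; rewrite lee_fin expR_ge0. Qed.

Lemma measurable_Xs k : measurable_fun [set: T] (X k).
Proof. exact: (measurable_funP (X k)). Qed.

Let measurable_expNslack n : measurable_fun [set: T]
  (fun w => (expR (- slack t n (Xs w)))%:E).
Proof.
apply/measurable_EFinP; apply: measurableT_comp => //; apply: measurable_funN.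
by apply: measurable_slack => j _; exact: measurable_Xs.
Qed.

Lemma escape_le1 n : escape n <= 1.
Proof.
rewrite -(probability_setT P) -[X in _ <= P X]setIT -integral_indic//.
apply: ge0_le_integral => //.
- by apply/measurable_EFinP; exact: measurable_indic.
- by move=> w _; rewrite lee_fin indicT -expR0 ler_expR oppr_le0 slack_ge0.
Qed.

Lemma escape_fin_num n : escape n \is a fin_num.
Proof.
by rewrite ge0_fin_numE ?escape_ge0// (le_lt_trans (escape_le1 n)) ?ltry.
Qed.

Lemma escape_nonincreasing n m : (n <= m)%N -> escape m <= escape n.
Proof.
move=> nm; apply: ge0_le_integral => //.
by move=> w _; rewrite lee_fin ler_expR lerN2 slack_le.
Qed.

Lemma escape_law (k : nat -> nat) n : injective k ->
  \int[P]_w (expR (- slack t n (fun j => X (k j) w)))%:E = escape n.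
Proof.
move=> k_inj; apply: (@ge0_integral_iid_law (fun i => X (k i)) n
    (fun x => (expR (- slack t n x))%:E)).
- exact: iid_std_exponential_comp.
- by move=> x z xz; rewrite (eq_slack t (z := z))// => j jn; apply: xz; lia.
- apply/measurable_EFinP; apply: measurableT_comp => //; apply: measurable_funN.
  apply: (@measurable_slack _ t _ _ (fun j (s : n.-tuple R) => nth 0%R s j)).
  by move=> j _; exact: measurable_nth_tuple.
- by move=> x; rewrite lee_fin expR_ge0.
Qed.

Lemma escape_after i n :
  \int[P]_w (expR (- slack t n (after i (Xs w))))%:E = escape n.
Proof. by apply: (@escape_law (fun j => i.+1 + j)%N) => ? ? /addnI. Qed.

Lemma escape_before i :
  \int[P]_w (expR (- slack t i (before i (Xs w))))%:E = escape i.
Proof.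
(* The reversal of the first i indices, extended by the identity to an injection of all indices. *)
pose k j := if (j < i)%N then (i.-1 - j)%N else j.
rewrite -(@escape_law k); last by move=> j1 j2; rewrite /k; do 2 case: ifP; lia.
apply: eq_integral => w _; rewrite (eq_slack t (z := fun j => X (k j) w))// => j ji.
by rewrite /k ifT//; lia.
Qed.

Lemma measurable_slack_before (Q : pred nat) i : (forall j, (j < i)%N -> Q j) ->
  measurable_fun [set: coordT X Q]
    ((fun w => slack t i (before i (Xs w))) : coordT X Q -> R).
Proof.
move=> Qi; apply: (@measurable_slack _ t _ (coordT X Q) (fun j w => X (i.-1 - j)%N w)) => j ji.
by apply: measurable_coord; apply: Qi; lia.
Qed.

Lemma measurable_slack_after (Q : pred nat) i n :
  (forall j, (i < j)%N -> Q j) ->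
  measurable_fun [set: coordT X Q]
    ((fun w => slack t n (after i (Xs w))) : coordT X Q -> R).
Proof.
move=> Qi; apply: (@measurable_slack _ t _ (coordT X Q) (fun j w => X (i.+1 + j)%N w)) => j ji.
by apply: measurable_coord; apply: Qi; lia.
Qed.

Hypothesis t0 : (0 <= t)%R.

(** Integrating out the kink leaves the exponential of a sum of three terms, and the slacks of the
    past and of the future are independent. *)
Lemma probability_contact N i : (0 < i < N)%N ->
  P [set w | contact t N (Xs w) i] =
  (expR (- t))%:E * (escape i * escape (N - i)).
Proof.
move=> /andP[i0 iN].
pose f w := (t + slack t i (before i (Xs w)) + slack t (N - i) (after i (Xs w)))%R.
have -> : [set w | contact t N (Xs w) i] = setT `&` [set w | f w <= X i w]%R.
  by rewrite setTI; apply/seteqP; split=> w /=; rewrite /contact /f; lra.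
rewrite (@probability_tail_indep _ _ _ _ _ iidX (predC1 i) i)//; last 3 first.
- by rewrite /= eqxx.
- apply: measurable_funD; first apply: measurable_funD => //.
    by apply: measurable_slack_before => j ji /=; lia.
  by apply: measurable_slack_after => j ji /=; lia.
- by move=> w _; rewrite /f !addr_ge0// slack_ge0.
have [indX _] := iidX.
rewrite -(escape_before i) -(escape_after i (N - i)).
rewrite -(@ge0_integral_indepM _ _ _ _ _ indX (fun j => j < i)%N (fun j => i < j)%N); last 5 first.
- by move=> k ki; rewrite -leqNgt ltnW.
- apply/measurable_EFinP; apply: measurableT_comp => //; apply: measurable_funN.
  exact: measurable_slack_before.
- apply/measurable_EFinP; apply: measurableT_comp => //; apply: measurable_funN.
  exact: measurable_slack_after.
- by move=> w; rewrite lee_fin expR_ge0.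
- by move=> w; rewrite lee_fin expR_ge0.
rewrite -ge0_integralZl//.
- apply: eq_integral => w _; rewrite indicT mul1r -!EFinM -!expRD.
  by congr (expR _)%:E; rewrite /f; ring.
- apply: emeasurable_funM; apply/measurable_EFinP; apply: measurableT_comp => //;
    apply: measurable_funN; apply: measurable_slack => j _; exact: measurable_Xs.
Qed.

(** This is e^t v_m. The exponent is what the two thresholds of a contact pair leave over:
    [end_slope] minus [start_slope] is the drift. *)
Definition bridge_weight m : \bar R := \int[P]_w
  ((expR (drift t m.-1 (Xs w)))%:E * (\1_[set w | bridge t m (Xs w)] w)%:E).

Lemma bridge_weight_after i m : \int[P]_w
  ((expR (drift t m.-1 (after i (Xs w))))%:E *
   (\1_[set w | bridge t m (after i (Xs w))] w)%:E) = bridge_weight m.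
Proof.
pose G x := (expR (drift t m.-1 x))%:E * ((bridge t m x)%:R%:E : \bar R).
transitivity (\int[P]_w G (fun k => X (i.+1 + k)%N w)).
  by apply: eq_integral => w _; rewrite /G indicE mem_setE.
transitivity (\int[P]_w G (Xs w)); last first.
  by apply: eq_integral => w _; rewrite /G indicE mem_setE.
apply: (@ge0_integral_iid_law (fun k => X (i.+1 + k)%N) m.-1).
- by apply: iid_std_exponential_comp => // ? ? /addnI.
- move=> x z xz; rewrite /G (eq_drift t (z := z))//; congr (_ * _%:R%:E).
  by apply: (congr1 nat_of_bool); apply: eq_bridge => j jm; apply: xz; lia.
- apply: emeasurable_funM.
    apply/measurable_EFinP; apply: measurableT_comp => //.
    apply: (@measurable_drift _ t _ _ (fun j (s : m.-1.-tuple R) => nth 0%R s j)).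
    by move=> j _; exact: measurable_nth_tuple.
  apply/measurable_EFinP.
  rewrite (_ : (fun s : m.-1.-tuple R => _) =
    \1_[set s : m.-1.-tuple R | bridge t m (nth 0%R s)]); last first.
    by apply/funext => s; rewrite indicE mem_setE.
  apply: measurable_indic.
  apply: (@measurable_bridge _ t _ _ (fun j (s : m.-1.-tuple R) => nth 0%R s j)).
  by move=> j _; exact: measurable_nth_tuple.
- by move=> x; rewrite mule_ge0// lee_fin expR_ge0.
Qed.

End contact_probabilities.

(** * Probability of a pair of consecutive contacts *)

Section contact_pair_probabilities.
Context d (T : measurableType d) (R : realType) (P : probability T R).
Variables (X : nat -> {RV P >-> R}) (t : R).
Hypothesis iidX : iid_std_exponential X.
Hypothesis t0 : 0 <= t.
Local Open Scope ereal_scope.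

Local Notation Xs w := (fun k : nat => X k w).

Let measurable_after_coord (Q : pred nat) i k :
  (forall j, (i < j < i + k)%N -> Q j) -> forall j, (j.+1 < k)%N ->
  measurable_fun [set: coordT X Q] (X (i.+1 + j)%N : coordT X Q -> R).
Proof. by move=> Qi j jk; apply: measurable_coord; apply: Qi; lia. Qed.

(** Neither threshold involves the other kink, so [X i] and [X j] can be integrated out in turn;
    what remains factors over the three blocks before i, between i and j, and after j. *)
Lemma probability_contact_pair N i j : (0 < i < j)%N -> (j < N)%N ->
  P [set w | contact_pair t N (Xs w) i j] =
  (expR (- t - t))%:E *
    (escape X t i * (bridge_weight X t (j - i) * escape X t (N - j))).
Proof.
move=> /andP[i0 ij] jN; have [indX _] := iidX.
pose m := (j - i)%N.
have m0 : (0 < m)%N by rewrite subn_gt0.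
pose z w := after i (Xs w).
pose f1 w := (t + start_slope t m (z w) + slack t i (before i (Xs w)))%R.
pose f2 w := (t - end_slope t m (z w) + slack t (N - j) (after j (Xs w)))%R.
pose B := [set w | bridge t m (z w)].
have f1_ge0 w : B w -> (0 <= f1 w)%R.
  move=> /(bridge_slopes m0)[s0 _].
  by rewrite /f1 !addr_ge0// slack_ge0.
have f2_ge0 w : B w -> (0 <= f2 w)%R.
  move=> /(bridge_slopes m0)[_ e0].
  by rewrite /f2 !addr_ge0 ?oppr_ge0// slack_ge0.
have mz (Q : pred nat) : (forall k, (i < k < j)%N -> Q k) -> forall k, (k.+1 < m)%N ->
    measurable_fun [set: coordT X Q] (X (i.+1 + k)%N : coordT X Q -> R).
  by move=> Qk; apply: measurable_after_coord => k; rewrite subnKC ?(ltnW ij)//; exact: Qk.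
have mB (Q : pred nat) : (forall k, (i < k < j)%N -> Q k) ->
    measurable (B : set (coordT X Q)).
  move=> /mz; exact: (@measurable_bridge _ t _ (coordT X Q) (fun k w => X (i.+1 + k)%N w)).
have mf1 (Q : pred nat) : (forall k, (k < i)%N || (i < k < j)%N -> Q k) ->
    measurable_fun [set: coordT X Q] (f1 : coordT X Q -> R).
  move=> Qk; apply: measurable_funD; first apply: measurable_funD => //.
    apply: (@measurable_start_slope _ t _ (coordT X Q) (fun k w => X (i.+1 + k)%N w)).
    by apply: mz => k kij; apply: Qk; rewrite kij orbT.
  by apply: measurable_slack_before => k ki; apply: Qk; rewrite ki.
have mf2 (Q : pred nat) : (forall k, (j < k)%N || (i < k < j)%N -> Q k) ->
    measurable_fun [set: coordT X Q] (f2 : coordT X Q -> R).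
  move=> Qk; apply: measurable_funD; first apply: measurable_funB => //.
    apply: (@measurable_end_slope _ t _ (coordT X Q) (fun k w => X (i.+1 + k)%N w)).
    by apply: mz => k kij; apply: Qk; rewrite kij orbT.
  by apply: measurable_slack_after => k ki; apply: Qk; rewrite ki.
have -> : [set w | contact_pair t N (Xs w) i j] =
    (B `&` [set w | f2 w <= X j w]%R) `&` [set w | f1 w <= X i w]%R.
  apply/seteqP; split=> w /=; first by move=> /and3P[].
  by move=> [[? ?] ?]; apply/and3P.
rewrite (@probability_tail_indep _ _ _ _ _ iidX (predC1 i) i)//; last 4 first.
- by rewrite /= eqxx.
- by apply: mf1 => k /=; lia.
- apply: measurableI; first by apply: mB => k /=; lia.
  apply: (@measurable_le_set R _ (coordT X (predC1 i))).
    by apply: mf2 => k /=; lia.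
  by apply: measurable_coord => /=; lia.
- by move=> w [Bw _]; exact: f1_ge0.
(* Once [X i] is gone, the rest is again a tail event, now for [X j], with weight [expR (- f1 w)] on
   [B]. *)
transitivity (\int[P]_w ((\1_B w * expR (- f1 w)) * \1_[set w | f2 w <= X j w]%R w)%:E).
  by apply: eq_integral => w _; rewrite indicI /= mulrAC.
rewrite (@integral_tail_indep _ _ _ _ _ iidX (predC1 j) j f2 (fun w => \1_B w * expR (- f1 w))%R)//; last 4 first.
- by rewrite /= eqxx.
- by apply: mf2 => k /=; lia.
- apply: measurable_funM.
    apply: (@measurable_indic _ (coordT X (predC1 j))).
    by apply: mB => k /=; lia.
  apply: measurableT_comp => //; apply: measurable_funN.
  by apply: mf1 => k /=; lia.
- move=> w; rewrite indicE; have [Bw _|_] := boolP (w \in B).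
    by apply: f2_ge0; rewrite inE in Bw.
  by rewrite mul0r ltxx.
pose gl w := (expR (- slack t i (before i (Xs w))))%:E.
pose gr w := (expR (- slack t (N - j) (after j (Xs w))))%:E.
pose gm w := (expR (drift t m.-1 (z w)))%:E * (\1_B w)%:E.
have gl0 w : 0 <= gl w by rewrite lee_fin expR_ge0.
have gr0 w : 0 <= gr w by rewrite lee_fin expR_ge0.
have gm0 w : 0 <= gm w by rewrite mule_ge0// lee_fin expR_ge0.
have mgl : measurable_fun [set: coordT X (fun k => k < i)%N]
    (gl : coordT X (fun k => k < i)%N -> \bar R).
  apply/measurable_EFinP; apply: measurableT_comp => //; apply: measurable_funN.
  exact: measurable_slack_before.
have mgr (Q : pred nat) : (forall k, (j < k)%N -> Q k) ->
    measurable_fun [set: coordT X Q] (gr : coordT X Q -> \bar R).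
  move=> Qk; apply/measurable_EFinP; apply: measurableT_comp => //; apply: measurable_funN.
  exact: measurable_slack_after.
have mgm (Q : pred nat) : (forall k, (i < k < j)%N -> Q k) ->
    measurable_fun [set: coordT X Q] (gm : coordT X Q -> \bar R).
  move=> Qk; apply: emeasurable_funM; apply/measurable_EFinP.
    apply: measurableT_comp => //.
    apply: (@measurable_drift _ t _ (coordT X Q) (fun k w => X (i.+1 + k)%N w)) => k km.
    by apply: mz => //; lia.
  by apply: (@measurable_indic _ (coordT X Q)); exact: mB.
have idm (Q : pred nat) : measurable_fun [set: T] (id : T -> coordT X Q).
  exact: measurable_id_coordT.
have <- : \int[P]_w gl w = escape X t i by exact: escape_before.
have <- : \int[P]_w gr w = escape X t (N - j) by exact: escape_after.
have <- : \int[P]_w gm w = bridge_weight X t m by exact: bridge_weight_after.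
rewrite -(@ge0_integral_indepM _ _ _ _ _ indX (fun k => i < k < j)%N (fun k => j < k)%N gm gr)//; last 3 first.
- by move=> k /andP[_ kj]; rewrite -leqNgt ltnW.
- exact: mgm.
- exact: mgr.
rewrite -(@ge0_integral_indepM _ _ _ _ _ indX (fun k => k < i)%N (fun k => i < k)%N gl (fun w => gm w * gr w))//; last 3 first.
- by move=> k ki; rewrite -leqNgt ltnW.
- apply: emeasurable_funM; first by apply: mgm => k /andP[].
  by apply: mgr => k; exact: ltn_trans.
- by move=> w; rewrite mule_ge0.
rewrite -ge0_integralZl//; last 2 first.
- apply: emeasurable_funM; first exact: (measurableT_comp mgl (idm _)).
  apply: emeasurable_funM.
    by apply: (measurableT_comp (mgm predT _) (idm _)).
  by apply: (measurableT_comp (mgr predT _) (idm _)).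
- by move=> w _; rewrite !mule_ge0.
apply: eq_integral => w _; rewrite /gl /gm /gr indicE.
case: (w \in B); last by rewrite !mul0r !(mule0, mul0e).
rewrite mul1r mule1 -!EFinM -!expRD; congr (expR _)%:E.
by rewrite /f1 /f2 /end_slope; ring.
Qed.

End contact_pair_probabilities.

(** * Chernoff bounds for the drift *)

Section chernoff.
Context d (T : measurableType d) (R : realType) (P : probability T R).
Variables (X : nat -> {RV P >-> R}) (t : R).
Hypothesis iidX : iid_std_exponential X.
Local Open Scope ereal_scope.

Local Notation Xs w := (fun k : nat => X k w).

Lemma measurable_driftX n : measurable_fun [set: T] (fun w => drift t n (Xs w)).
Proof. by apply: measurable_drift => j _; exact: measurable_Xs. Qed.

Lemma drift_laplace n (c : R) : (0 <= c)%R ->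
  \int[P]_w (expR (- (c * drift t n (Xs w))))%:E = ((expR (c * t) / (1 + c)) ^+ n)%:E.
Proof.
move=> c0; have [indX expX] := iidX.
elim: n => [|n IH].
  rewrite expr0 -[RHS](probability_setT P) -[X in _ = P X]setIT -integral_indic//.
  by apply: eq_integral => w _; rewrite drift0 mulr0 oppr0 expR0 indicT.
rewrite exprSr EFinM -IH.
have -> : ((expR (c * t) / (1 + c))%:E = (expR (c * t))%:E * \int[P]_w (expR (- (c * X n w)))%:E).
  by rewrite std_exponential_laplace// -EFinM.
have mE : measurable_fun [set: coordT X (fun k => k == n)]
    ((fun w => (expR (- (c * X n w)))%:E) : coordT X (fun k => k == n) -> \bar R).
  apply/measurable_EFinP; apply: measurableT_comp => //; apply: measurable_funN.
  by apply: measurable_funM => //; apply: measurable_coord; rewrite eqxx.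
rewrite -ge0_integralZl//; last first.
  exact: (measurableT_comp mE (@measurable_id_coordT _ _ _ _ X _)).
rewrite -(@ge0_integral_indepM _ _ _ _ _ indX (fun k => k < n)%N (fun k => k == n)); last 5 first.
- by move=> k kn; rewrite lt_eqF.
- apply/measurable_EFinP; apply: measurableT_comp => //; apply: measurable_funN.
  apply: measurable_funM => //.
  apply: (@measurable_drift _ t _ (coordT X (fun k => k < n)%N) (fun k w => X k w)) => k kn.
  exact: measurable_coord.
- exact: emeasurable_funM.
- by move=> w; rewrite lee_fin expR_ge0.
- by move=> w; rewrite mule_ge0// lee_fin expR_ge0.
apply: eq_integral => w _; rewrite -!EFinM -!expRD driftS.
by congr (expR _)%:E; ring.
Qed.

Lemma drift_chernoff n (c M : R) : (0 <= c)%R ->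
  P [set w | drift t n (Xs w) <= - M]%R <=
  (expR (- (c * M)) * (expR (c * t) / (1 + c)) ^+ n)%:E.
Proof.
move=> c0; rewrite EFinM -drift_laplace//.
have mD : measurable_fun [set: T] (fun w => (expR (- (c * drift t n (Xs w))))%:E).
  apply/measurable_EFinP; apply: measurableT_comp => //; apply: measurable_funN.
  by apply: measurable_funM => //; exact: measurable_driftX.
rewrite -ge0_integralZl// -[X in P X]setIT -integral_indic//; last first.
  by apply: measurable_le_set => //; exact: measurable_driftX.
apply: ge0_le_integral => //.
- apply/measurable_EFinP; apply: measurable_indic.
  by apply: measurable_le_set => //; exact: measurable_driftX.
- exact: emeasurable_funM.
move=> w _; rewrite -EFinM lee_fin -expRD indicE.
case: (boolP (w \in _)); last by rewrite expR_ge0.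
rewrite inE /= => dM; rewrite -[leLHS]expR0 ler_expR.
have : (0 <= c * (- M - drift t n (Xs w)))%R by rewrite mulr_ge0// subr_ge0.
lra.
Qed.

Hypothesis t01 : (0 < t < 1)%R.

(** The minimum over c >= 0 of e^(c t)/(1+c), attained at c = 1/t - 1. *)
Definition chernoff_rate : R := t * expR (1 - t).

Lemma chernoff_rate_bounds : (0 <= chernoff_rate < 1)%R.
Proof.
move: t01 => /andP[t0 t1]; rewrite /chernoff_rate mulr_ge0 ?expR_ge0 ?ltW//=.
have : (1 + (t - 1) < expR (t - 1))%R by apply: expR_gt1Dx; lra.
rewrite -(opprB 1 t) expRN => H.
by rewrite -ltr_pdivlMr ?expR_gt0// div1r; lra.
Qed.

Lemma chernoff_rateE :
  (expR ((t^-1 - 1) * t) / (1 + (t^-1 - 1)))%R = chernoff_rate.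
Proof.
move: t01 => /andP[t0 t1]; rewrite /chernoff_rate mulrBl mulVf ?gt_eqF// mul1r.
by rewrite addrCA subrr addr0 invrK mulrC.
Qed.

Let tV1 : (0 <= t^-1 - 1)%R.
Proof. by move: t01 => /andP[t0 t1]; rewrite subr_ge0 invf_ge1 ?ltW. Qed.

Lemma drift_le0_probability n :
  P [set w | drift t n (Xs w) <= 0]%R <= (chernoff_rate ^+ n)%:E.
Proof.
have := drift_chernoff n 0 tV1.
by rewrite oppr0 mulr0 oppr0 expR0 mul1r chernoff_rateE.
Qed.

(** For large M, a union bound keeps all the partial sums above -M with probability at least 1/2,
    and the slack is then at most M. *)
Lemma escape_lower_bound : exists2 e : R, (0 < e)%R &
  forall n, (0 < n)%N -> e%:E <= escape X t n.
Proof.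
have /andP[r0 r1] := chernoff_rate_bounds.
set c := (t^-1 - 1)%R.
have c0 : (0 < c)%R by move: t01 => /andP[? ?]; rewrite subr_gt0 invf_gt1.
have [M M0 MP] : exists2 M : R, (0 <= M)%R &
    (expR (- (c * M)) / (1 - chernoff_rate) <= 2^-1)%R.
  (* As e^y >= y, the choice M = y/c gives e^(-c M) <= 1/y, which is half of 1 minus the rate. *)
  pose y := (2 / (1 - chernoff_rate))%R.
  have y0 : (0 < y)%R by rewrite divr_gt0// subr_gt0.
  exists (y / c)%R; first by rewrite divr_ge0// ltW.
  rewrite (mulrC c) divfK ?gt_eqF// ler_pdivrMr ?subr_gt0// expRN.
  rewrite -[leRHS]invrK lef_pV2 ?posrE ?expR_gt0 ?invr_gt0 ?mulr_gt0 ?invr_gt0 ?subr_gt0//.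
  rewrite invfM invrK -/y (le_trans _ (expR_ge1Dx _))//; lra.
exists (expR (- M) / 2)%R; first by rewrite divr_gt0// expR_gt0.
move=> n n0.
pose F i := [set w | drift t i (Xs w) <= - M]%R.
have mF i : measurable (F i).
  by apply: measurable_le_set => //; exact: measurable_driftX.
pose U := \big[setU/set0]_(i < n) F i.
have mU : measurable U by exact: bigsetU_measurable.
have PU : P U <= (2^-1)%:E.
  apply: (@le_trans _ _ (\sum_(i < n) P (F i))).
    by apply: Boole_inequality => i _; exact: mF.
  apply: (@le_trans _ _ (\sum_(i < n) (expR (- (c * M)) * chernoff_rate ^+ i)%:E)).
    by apply: lee_sum => i _; rewrite -chernoff_rateE; exact: (drift_chernoff i M (ltW c0)).
  rewrite sumEFin lee_fin -mulr_sumr (le_trans _ MP)// ler_wpM2l ?expR_ge0//.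
  rewrite -[leRHS]div1r ler_pdivlMr ?subr_gt0//.
  by have := subrX1 chernoff_rate n; have := exprn_ge0 n r0; lra.
have PG : (2^-1)%:E <= P (~` U).
  rewrite probability_setC//.
  rewrite leeBrDr ?fin_num_measure//.
  apply: (le_trans (leeD2l _ PU)); rewrite -EFinD lee_fin; lra.
apply: (@le_trans _ _ ((expR (- M))%:E * P (~` U))).
  by rewrite EFinM lee_wpmul2l// lee_fin expR_ge0.
rewrite -[X in P X]setIT -integral_indic//; last exact: measurableC.
rewrite -ge0_integralZl//; last first.
  by apply/measurable_EFinP; apply: measurable_indic; exact: measurableC.
apply: ge0_le_integral => //.
- apply: emeasurable_funM => //.
  by apply/measurable_EFinP; apply: measurable_indic; exact: measurableC.
- apply/measurable_EFinP; apply: measurableT_comp => //; apply: measurable_funN.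
  by apply: measurable_slack => j _; exact: measurable_Xs.
move=> w _; rewrite -EFinM lee_fin indicE.
case: (boolP (w \in _)); last by rewrite mulr0 expR_ge0.
rewrite inE /= => Uw; rewrite mulr1 ler_expR lerN2.
apply: drift_ge_slack => // i /andP[i0 i_n].
rewrite leNgt; apply/negP => di; apply: Uw.
by rewrite /U -bigcup_mkord; exists i => //=; rewrite /F /= ltW.
Qed.

End chernoff.

(** * The renewal identity *)

Section renewal.
Context d (T : measurableType d) (R : realType) (P : probability T R).
Variables (X : nat -> {RV P >-> R}).
Hypothesis iidX : iid_std_exponential X.
Local Open Scope ereal_scope.

Local Notation Xs w := (fun k : nat => X k w).

(** Time 0 behaves like a contact with only a future: a horizontal line supports the path there
    exactly when the first step [X 0 - t] is at least the right slack. *)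
Lemma survival_probability (t : R) n : (0 <= t)%R -> (0 < n)%N ->
  P [set w | forall k, (k < n)%N -> 0 <= iwalk t k.+1 (Xs w)]%R =
  (expR (- t))%:E * escape X t n.
Proof.
move=> t0 n0.
pose f w := (t + slack t n (after 0 (Xs w)))%R.
have -> : [set w | forall k, (k < n)%N -> 0 <= iwalk t k.+1 (Xs w)]%R =
    setT `&` [set w | f w <= X 0%N w]%R.
  have E w : (f w <= X 0%N w)%R <->
      forall k, (k < n)%N -> (0 <= iwalk t k.+1 (Xs w))%R.
    have := @slack_afterP _ t (Xs w) 0 n 0 n0.
    rewrite /f iwalkS iwalk0 driftS drift0 !add0r !subr0 => H.
    split=> [fX k kn|Hk].
      have /H/(_ k kn) : (slack t n (after 0 (Xs w)) <= X 0%N w - t)%R by lra.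
      by rewrite mul0r addr0.
    have : (slack t n (after 0 (Xs w)) <= X 0%N w - t)%R; last by lra.
    by apply/H => k kn; rewrite mul0r addr0; exact: Hk.
  by rewrite setTI; apply/seteqP; split=> w /=; [move=> H; apply/E | move=> H; apply/E].
rewrite (@probability_tail_indep _ _ _ _ _ iidX (predC1 0%N) 0%N)//; last 2 first.
- apply: measurable_funD => //.
  by apply: measurable_slack_after => j /=; lia.
- by move=> w _; rewrite /f addr_ge0// slack_ge0.
rewrite -(escape_after t iidX 0 n) -ge0_integralZl//.
- by apply: eq_integral => w _; rewrite indicT mul1r -EFinM -expRD /f opprD.
- apply/measurable_EFinP; apply: measurableT_comp => //; apply: measurable_funN.
  by apply: measurable_slack => j _; exact: measurable_Xs.
Qed.

(* V_m: the factor e^(X_0 + ... + X_(m-2)) turns the joint law of the gaps into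
   Lebesgue measure. *)
Definition bridge_volume m : \bar R := \int[P]_w
  ((expR (\sum_(i < m.-1) X i w))%:E * (\1_[set w | bridge 1%R m (Xs w)] w)%:E).

(** The exponential of the drift is that of the sum of the gaps up to a constant, dividing the gaps
    by t carries the bridges at t to those at 1, and homogeneity yields t^(m-1). *)
Lemma bridge_weightE (t : R) m : (0 < t)%R ->
  bridge_weight X t m =
  (expR (- (m.-1%:R * t)) * t ^+ m.-1)%:E * bridge_volume m.
Proof.
move=> t0; pose n := m.-1.
pose g (s : n.-tuple R) := (bridge 1%R m (nth 0%R s))%:R%:E : \bar R.
have mg : measurable_fun [set: n.-tuple R] g.
  apply/measurable_EFinP.
  rewrite (_ : (fun s : n.-tuple R => _) =
    \1_[set s : n.-tuple R | bridge 1%R m (nth 0%R s)]); last first.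
    by apply/funext => s; rewrite indicE mem_setE.
  apply: measurable_indic.
  apply: (@measurable_bridge _ 1%R _ _ (fun j (s : n.-tuple R) => nth 0%R s j)).
  by move=> j _; exact: measurable_nth_tuple.
have g0 s : 0 <= g s by rewrite lee_fin.
have mS : measurable_fun [set: T] (fun w => (expR (\sum_(i < n) X i w))%:E).
  apply/measurable_EFinP; apply: measurableT_comp => //.
  by apply: measurable_sum => i; exact: measurable_Xs.
have mgX r : measurable_fun [set: T] (fun w => g (scaled_tuple X n r w)).
  by apply: (measurableT_comp mg); exact: measurableT_scaled_tuple.
have gE r w : g (scaled_tuple X n r w) = (bridge 1%R m (fun k => r * X k w)%R)%:R%:E.
  congr (_%:R%:E); apply: (congr1 nat_of_bool); apply: eq_bridge => j jm.
  by rewrite nth_scaled_tuple//; rewrite /n; lia.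
transitivity ((expR (- (n%:R * t)))%:E *
    \int[P]_w ((expR (\sum_(i < n) X i w))%:E * g (scaled_tuple X n t^-1 w))).
  rewrite -ge0_integralZl//.
  - apply: eq_integral => w _; rewrite indicE mem_setE gE [in RHS]muleA.
    have -> (a b : R) (c : \bar R) : (expR a)%:E * (expR b)%:E * c = (expR (a + b))%:E * c.
      by rewrite expRD EFinM.
    congr ((expR _)%:E * _%:R%:E).
      by rewrite /drift sumrB sumr_const card_ord -/n mulr_natl addrC.
    exact: (congr1 nat_of_bool (bridge_scale m (Xs w) t0)).
  - exact: emeasurable_funM.
  - by move=> w _; rewrite mule_ge0// lee_fin expR_ge0.
rewrite (ge0_integral_tuple_scale t0 iidX mg g0) muleA -EFinM; congr (_ * _).
apply: eq_integral => w _; rewrite gE indicE mem_setE; congr (_ * _%:R%:E).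
by apply: (congr1 nat_of_bool); apply: eq_bridge => j _; rewrite mul1r.
Qed.

Definition no_contact (t : R) N : set T :=
  [set w | forall k, (0 < k < N)%N -> ~~ contact t N (Xs w) k].

Lemma measurable_contact t N i : measurable [set w | contact t N (Xs w) i].
Proof.
apply: measurable_le_set.
  apply: measurable_funD.
    by apply: (@measurable_slack _ t _ _ (fun j w => X (i.-1 - j)%N w)) => j _;
      exact: measurable_Xs.
  by apply: (@measurable_slack _ t _ _ (fun j w => X (i.+1 + j)%N w)) => j _;
    exact: measurable_Xs.
by apply: measurable_funB => //; exact: measurable_Xs.
Qed.

Lemma measurable_contact_pair t N i j :
  measurable [set w | contact_pair t N (Xs w) i j].
Proof.
have mb k n : measurable_fun [set: T] (fun w => slack t n (after k (Xs w))).
  by apply: (@measurable_slack _ t _ _ (fun j w => X (k.+1 + j)%N w)) => l _;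
    exact: measurable_Xs.
rewrite (_ : [set w | _] = [set w | bridge t (j - i) (after i (Xs w))] `&`
  ([set w | t + start_slope t (j - i) (after i (Xs w)) +
              slack t i (before i (Xs w)) <= X i w]%R `&`
   [set w | t - end_slope t (j - i) (after i (Xs w)) +
              slack t (N - j) (after j (Xs w)) <= X j w]%R)); last first.
  apply/seteqP; split=> w /=; first by move=> /and3P[].
  by move=> [? [? ?]]; apply/and3P.
apply: measurableI.
  by apply: (@measurable_bridge _ t _ _ (fun k w => X (i.+1 + k)%N w)) => k _;
    exact: measurable_Xs.
apply: measurableI; apply: measurable_le_set; try exact: measurable_Xs.
  apply: measurable_funD; first apply: measurable_funD => //.
    by apply: (@measurable_start_slope _ t _ _ (fun k w => X (i.+1 + k)%N w)) => k _;
      exact: measurable_Xs.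
  by apply: (@measurable_slack _ t _ _ (fun j w => X (i.-1 - j)%N w)) => k _;
    exact: measurable_Xs.
apply: measurable_funD => //; apply: measurable_funB => //.
by apply: (@measurable_end_slope _ t _ _ (fun k w => X (i.+1 + k)%N w)) => k _;
  exact: measurable_Xs.
Qed.

Lemma measurable_no_contact t N : measurable (no_contact t N).
Proof.
rewrite (_ : no_contact t N = \bigcap_(k in [set k | (0 < k < N)%N])
    ~` [set w | contact t N (Xs w) k]); last first.
  by apply/seteqP; split=> w /= H k /H; move/negP.
apply: bigcap_measurableType => k _; apply: measurableC; exact: measurable_contact.
Qed.

Lemma count_contacts t N w : (0 < N)%N ->
  (1 + \sum_(1 <= j < N) \sum_(1 <= i < j)
     \1_[set w | contact_pair t N (Xs w) i j] w =
   \1_(no_contact t N) w + \sum_(1 <= i < N) \1_[set w | contact t N (Xs w) i] w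
   :> R)%R.
Proof.
move=> N0; have := count_consecutive (contact t N (Xs w)) N0.
move=> /(congr1 (fun n => n%:R : R)); rewrite !natrD !natr_sum => E.
transitivity (1 + \sum_(1 <= j < N) (\sum_(1 <= i < j)
   [&& contact t N (Xs w) i, contact t N (Xs w) j
     & ~~ has (contact t N (Xs w)) (index_iota i.+1 j)])%N%:R : R)%R.
  congr (_ + _)%R; apply: eq_big_nat => j /andP[j1 jN].
  rewrite natr_sum; apply: eq_big_nat => i /andP[i1 ij].
  rewrite indicE; congr (_%:R); apply: (congr1 nat_of_bool).
  apply/idP/idP; rewrite inE /= => H.
    have /contact_pairP[]// := H; first by rewrite i1.
    move=> ci cj no; rewrite ci cj /=; apply/hasPn => k.
    by rewrite mem_index_iota => /no.
  apply/contact_pairP; rewrite ?i1//; move: H => /and3P[ci cj /hasPn no].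
  by split=> // k kij; apply: no; rewrite mem_index_iota.
rewrite E; congr (_ + _)%R; last first.
  by apply: eq_bigr => i _; rewrite indicE mem_setE.
rewrite indicE; congr (_%:R); apply: (congr1 nat_of_bool).
apply/idP/idP; rewrite inE.
  by move=> /hasPn no k kN; apply: no; rewrite mem_index_iota.
by move=> no; apply/hasPn => k; rewrite mem_index_iota => /no.
Qed.

(** The expectation of [count_contacts]. *)
Lemma renewal_identity t N : (0 < N)%N ->
  1 + \sum_(1 <= j < N) \sum_(1 <= i < j) P [set w | contact_pair t N (Xs w) i j] =
  P (no_contact t N) + \sum_(1 <= i < N) P [set w | contact t N (Xs w) i].
Proof.
move=> N0.
have PE A : measurable A -> P A = \int[P]_w (\1_A w)%:E.
  by move=> mA; rewrite integral_indic// setIT.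
have mI A : measurable A -> measurable_fun [set: T] (fun w => (\1_A w)%:E : \bar R).
  by move=> mA; apply/measurable_EFinP; exact: measurable_indic.
rewrite -(probability_setT P) !PE//; last exact: measurable_no_contact.
under eq_bigr => j _ do under eq_bigr => i _ do
  rewrite (PE _ (measurable_contact_pair t N i j)).
under [in RHS]eq_bigr => i _ do rewrite (PE _ (measurable_contact t N i)).
have mc i := mI _ (measurable_contact t N i).
have mp i j := mI _ (measurable_contact_pair t N i j).
under eq_bigr => j _ do rewrite -ge0_integral_sum//.
rewrite -ge0_integral_sum//; last 2 first.
- by move=> j; apply: emeasurable_sum.
- by move=> j w _; apply: sume_ge0.
rewrite -ge0_integral_sum// -!ge0_integralD//; last 6 first.
- by apply: mI; exact: measurable_no_contact.
- by move=> w _; apply: sume_ge0.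
- exact: emeasurable_sum.
- exact: mI.
- by move=> w _; apply: sume_ge0 => j _; apply: sume_ge0.
- by apply: emeasurable_sum => j; exact: emeasurable_sum.
apply: eq_integral => w _.
under eq_bigr do rewrite sumEFin; rewrite !sumEFin -!EFinD indicT.
by rewrite count_contacts.
Qed.

(** Without contacts the path minus its chord is a bridge over [0, N], whose slope passes from
    nonnegative to nonpositive; hence the drift of the N - 1 interior gaps is at most 0. *)
Lemma no_contact_probability t N : (0 < t < 1)%R -> (0 < N)%N ->
  P (no_contact t N) <= (chernoff_rate t ^+ N.-1)%:E.
Proof.
move=> t01 N0.
have iidY : iid_std_exponential (fun k => X k.+1).
  by apply: iid_std_exponential_comp => // ? ? [].
apply: le_trans (drift_le0_probability iidY t01 N.-1).
apply: le_measure; rewrite ?inE//.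
- exact: measurable_no_contact.
- apply: measurable_le_set => //; apply: measurable_drift => j _; exact: measurable_Xs.
- move=> w /no_contact_bridge => /(_ N0) br /=.
  have [s0 e0] := bridge_slopes N0 br.
  by move: e0; rewrite /end_slope /after; lra.
Qed.

End renewal.

(** * The renewal equation *)

Section generating_functions.
Context (R : realType).
Implicit Types (f g : nat -> R) (s : R).

(** Both indices stay positive, and [gen] starts at exponent 1 accordingly: contacts are interior
    and blocks have positive length. *)
Definition conv f g n : R := \sum_(1 <= i < n) f i * g (n - i)%N.

Definition gen f s : \bar R := (\sum_(n <oo) (f n.+1 * s ^+ n.+1)%:E)%E.

Lemma conv_ge0 f g n : (forall k, 0 <= f k) -> (forall k, 0 <= g k) ->
  0 <= conv f g n.
Proof. by move=> f0 g0; apply: sumr_ge0 => i _; rewrite mulr_ge0. Qed.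

Lemma gen_ge0 f s : (forall k, 0 <= f k) -> 0 <= s -> (0 <= gen f s)%E.
Proof.
by move=> f0 s0; apply: nneseries_ge0 => n _ _; rewrite lee_fin mulr_ge0// exprn_ge0.
Qed.

Lemma gen_le f g s : (forall k, 0 <= f k) -> 0 <= s ->
  (forall k, (0 < k)%N -> f k <= g k) -> (gen f s <= gen g s)%E.
Proof.
move=> f0 s0 fg; apply: lee_nneseries => n *.
  by rewrite lee_fin mulr_ge0// exprn_ge0.
by rewrite lee_fin ler_wpM2r ?exprn_ge0// fg.
Qed.

Lemma eq_gen f g s : (forall k, (0 < k)%N -> f k = g k) -> gen f s = gen g s.
Proof. by move=> fg; apply: eq_eseriesr => n _; rewrite fg. Qed.

Lemma genD f g s : (forall k, 0 <= f k) -> (forall k, 0 <= g k) -> 0 <= s ->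
  gen (fun n => f n + g n) s = (gen f s + gen g s)%E.
Proof.
move=> f0 g0 s0; rewrite /gen -nneseriesD; last 2 first.
- by move=> *; rewrite lee_fin mulr_ge0// exprn_ge0.
- by move=> *; rewrite lee_fin mulr_ge0// exprn_ge0.
by apply: eq_eseriesr => n _; rewrite -EFinD mulrDl.
Qed.

Lemma genZ c f s : (forall k, 0 <= f k) -> 0 <= s ->
  gen (fun n => c * f n) s = (c%:E * gen f s)%E.
Proof.
move=> f0 s0; rewrite /gen -nneseriesZl; last first.
  by move=> *; rewrite lee_fin mulr_ge0// exprn_ge0.
by apply: eq_eseriesr => n _; rewrite -EFinM mulrA.
Qed.

Lemma gen_le_bound f s B : (forall k, 0 <= f k) -> 0 <= s ->
  (forall n, \sum_(i < n) f i.+1 * s ^+ i.+1 <= B) -> (gen f s <= B%:E)%E.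
Proof.
move=> f0 s0 fB; apply: lime_le.
  by apply: is_cvg_nneseries => n *; rewrite lee_fin mulr_ge0// exprn_ge0.
by apply: nearW => n; rewrite sumEFin lee_fin big_mkord.
Qed.

Lemma gen_cst1 s : 0 <= s < 1 -> gen (fun=> 1) s = (s / (1 - s))%:E.
Proof.
move=> /andP[s0 s1]; have s1' : `|s| < 1 by rewrite ger0_norm.
rewrite -(cvg_lim _ (cvg_geometric_series s1'))// -EFin_lim; last first.
  exact: is_cvg_geometric_series.
congr (limn _); apply/funext => n; rewrite /= sumEFin /series/=.
by congr EFin; apply: eq_bigr => i _; rewrite mul1r exprS.
Qed.

(** Tonelli for nonnegative terms. Infinite values are allowed because the finiteness of the series
    of v is deduced only afterwards, from the renewal equation. *)
Lemma gen_conv f g s : (forall k, 0 <= f k) -> (forall k, 0 <= g k) -> 0 <= s ->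
  gen (conv f g) s = (gen f s * gen g s)%E.
Proof.
move=> f0 g0 s0.
pose F i := f i.+1 * s ^+ i.+1; pose G i := g i.+1 * s ^+ i.+1.
have F0 i : 0 <= F i by rewrite mulr_ge0// exprn_ge0.
have G0 i : 0 <= G i by rewrite mulr_ge0// exprn_ge0.
pose h n i := (if (i < n)%N then F i * G (n - i.+1)%N else 0)%:E.
have h0 n i : (0 <= h n i)%E by rewrite lee_fin; case: ifP => // _; exact: mulr_ge0.
transitivity (\sum_(n <oo) \sum_(i <oo) h n i)%E.
  apply: eq_eseriesr => n _.
  rewrite (nneseries_split 0%N n)// add0n [X in (_ + X)%E]eseries0; last first.
    by move=> i ni _; rewrite /h ltnNge ni.
  rewrite adde0 sumEFin; congr EFin.
  rewrite /conv big_add1 /= mulr_suml; apply: eq_big_nat => i /andP[_ i_n].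
  rewrite i_n /F /G subSS.
  have -> : (n - i = (n - i.+1).+1)%N by lia.
  rewrite mulrACA -exprD; congr (_ * _ ^+ _); lia.
rewrite nneseries_interchange//.
have G_ge0 : (0 <= gen g s)%E by exact: gen_ge0.
transitivity (\sum_(i <oo) ((F i)%:E * gen g s))%E.
  apply: eq_eseriesr => i _.
  rewrite (nneseries_split 0%N i.+1)// add0n big1_seq ?add0e; last first.
    move=> n /andP[_]; rewrite mem_index_iota => /andP[_ ni].
    by rewrite /h ltnNge -ltnS ni.
  rewrite -(nneseries_addn (f := h^~ i))// -nneseriesZl; last first.
    by move=> k _; rewrite lee_fin; exact: (G0 k).
  apply: eq_eseriesr => k _; rewrite /h addnK -EFinM.
  by have -> : (i < k + i.+1)%N by lia.
have [gfin|] := boolP (gen g s \is a fin_num).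
  under eq_eseriesr do rewrite muleC -(fineK gfin).
  rewrite nneseriesZl; last by move=> *; rewrite lee_fin.
  by rewrite fineK// muleC.
rewrite ge0_fin_numE// -leNgt leye_eq => /eqP ->.
(* With an infinite second factor, the product is 0 or infinite according to whether all terms of
   the first vanish. *)
have [allF|[i Fi]] : (forall i, F i = 0) \/ exists i, F i != 0.
- case: (pselect (exists i, F i != 0)) => [?|nF]; [by right|left=> i].
  by apply/eqP; apply: contra_notT nF => Fi; exists i.
- have -> : gen f s = 0%E.
    by apply: eseries0 => i _ _; exact: (congr1 EFin (allF i)).
  by rewrite mul0e; apply: eseries0 => i _ _; rewrite allF mul0e.
have Fi0 : 0 < F i by rewrite lt_neqAle eq_sym Fi F0.
have F0' n : (0 <= (F n)%:E)%E by rewrite lee_fin.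
have le1 := @nneseries_lim_ge _ (fun n => (F n)%:E) xpredT 0%N i.+1
  (fun n _ _ => F0' n).
have le2 := @nneseries_lim_ge _ (fun n => (F n)%:E * +oo)%E xpredT 0%N i.+1
  (fun n _ _ => mule_ge0 (F0' n) le0y).
rewrite gt0_muley; last first.
  apply: lt_le_trans le1; rewrite sumEFin lte_fin big_mkord big_ord_recr/=.
  by rewrite ltr_wpDl// sumr_ge0.
apply/eqP; rewrite -leye_eq; apply: le_trans le2.
rewrite big_mkord big_ord_recr/= gt0_muley ?lte_fin// addey//.
by rewrite -ltNye (lt_le_trans (ltNyr 0))// sume_ge0// => j _; rewrite mule_ge0// lee_fin.
Qed.

End generating_functions.

(** * The renewal equation for generating functions *)

Section renewal_equation.
Context (R : realType).
Variables (a v c : nat -> R) (w K : R).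
Hypotheses (w0 : 0 < w) (a_gt0 : forall n, 0 < a n) (a_le1 : forall n, a n <= 1).
Hypotheses (v0 : forall n, 0 <= v n).
Hypotheses (c0 : forall n, 0 <= c n) (c1 : forall n, c n <= 1).
Hypothesis cK : forall n, \sum_(i < n) c i.+1 <= K.
Hypothesis a_mono : forall n m, (n <= m)%N -> a m <= a n.
Hypothesis renewal : forall n, (0 < n)%N ->
  1 + w * conv (conv a v) a n = c n + w * conv a a n.

Lemma sum_ltn_le m n : (\sum_(i < m) (i < n) <= n)%N.
Proof.
have : (\sum_(i < m) (i < n) <= minn m n)%N; last by lia.
elim: m => [|m IH]; first by rewrite big_ord0.
rewrite big_ord_recr; apply: leq_trans (leq_add IH (leqnn _)) _ => /=.
by case: (ltnP m n); lia.
Qed.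

Lemma gen_renewal s : 0 < s < 1 -> exists A vs C : R,
  [/\ gen v s = vs%:E, 0 <= C, C <= K & C <= s / (1 - s)] /\
  [/\ s / (1 - s) + w * A ^+ 2 * vs = C + w * A ^+ 2,
      forall r, 0 <= r -> (forall n, r <= a n) -> r * (s / (1 - s)) <= A,
      forall n, A <= n%:R + a n * (s / (1 - s)) & 0 < A].
Proof.
move=> /andP[s0 s1]; have s01 : 0 <= s < 1 by rewrite ltW.
have s0' := ltW s0; have a0 n := ltW (a_gt0 n).
set G := s / (1 - s).
have G0 : 0 < G by rewrite divr_gt0// subr_gt0.
have genr r : 0 <= r -> gen (fun=> r) s = (r * G)%:E.
  move=> r0; rewrite (@eq_gen _ (fun=> r) (fun=> r * 1)); last by move=> *; rewrite mulr1.
  by rewrite (@genZ _ r (fun=> 1))// gen_cst1.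
(* Terms of index below n are at most 1, all others at most [a n]. *)
have Aup n : (gen a s <= (n%:R + a n * G)%:E)%E.
  apply: (@le_trans _ _ (gen (fun k => (k < n)%:R + a n) s)).
    apply: gen_le => // k k0; have [kn|nk] := ltnP k n.
      by rewrite (le_trans (a_le1 k))// lerDl.
    by rewrite add0r a_mono.
  rewrite genD// EFinD; apply: leeD; last by rewrite genr.
  apply: gen_le_bound => // m.
  apply: (@le_trans _ _ (\sum_(i < m) (i < n)%:R)); last first.
    by rewrite -natr_sum ler_nat sum_ltn_le.
  apply: ler_sum => i _; apply: (@le_trans _ _ (i.+1 < n)%:R).
    by rewrite ler_piMr// exprn_ile1// ltW.
  by rewrite ler_nat; case: (ltnP i.+1 n) => // /ltnW ->.
have Afin : gen a s \is a fin_num.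
  by rewrite ge0_fin_numE ?gen_ge0// (le_lt_trans (Aup 0%N)) ?ltry.
have Clow := gen_ge0 c0 s0'.
have CG : (gen c s <= G%:E)%E.
  by rewrite -[G]mul1r -genr//; apply: gen_le.
have CK : (gen c s <= K%:E)%E.
  apply: gen_le_bound => // n; apply: le_trans (cK n); apply: ler_sum => i _.
  by rewrite ler_piMr// exprn_ile1// ltW.
have Cfin : gen c s \is a fin_num.
  by rewrite ge0_fin_numE// (le_lt_trans CG) ?ltry.
have Alow r : 0 <= r -> (forall n, r <= a n) -> r * G <= fine (gen a s).
  move=> r0 ra; rewrite -lee_fin fineK// -genr//; exact: gen_le.
have A0 : 0 < fine (gen a s).
  have s1s : (s%:E * (a 1%N)%:E <= gen a s)%E.
    have := @nneseries_lim_ge _ (fun n => (a n.+1 * s ^+ n.+1)%:E) xpredT 0%N 1.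
    rewrite big_nat1 expr1 mulrC -EFinM; apply=> n _ _.
    by rewrite lee_fin mulr_ge0// exprn_ge0.
  by rewrite -lte_fin fineK// (lt_le_trans _ s1s)// -EFinM lte_fin mulr_gt0.
have conv0 n : 0 <= conv a a n by exact: conv_ge0.
have convv0 n : 0 <= conv a v n by exact: conv_ge0.
have convva0 n : 0 <= conv (conv a v) a n by exact: conv_ge0.
have : gen (fun n => 1 + w * conv (conv a v) a n) s =
       gen (fun n => c n + w * conv a a n) s by exact: eq_gen.
rewrite genD//; last by move=> k; rewrite mulr_ge0// ltW.
rewrite genD//; last by move=> k; rewrite mulr_ge0// ltW.
rewrite !genZ ?(ltW w0)// !gen_conv// genr// mul1r.
rewrite -(fineK Afin) -(fineK Cfin).
set A := fine (gen a s); set C := fine (gen c s) => E.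
(* As A is positive, an infinite series of v would make the left side infinite while the right side
   is finite. *)
have vfin : gen v s \is a fin_num.
  rewrite ge0_fin_numE ?gen_ge0// ltNge leye_eq; apply/negP => /eqP vy.
  move: E; rewrite vy gt0_muley ?lte_fin// gt0_mulye ?lte_fin//.
  by rewrite gt0_muley ?lte_fin// addey.
move: E; rewrite -(fineK vfin) -!EFinM -!EFinD => -[E].
have CE : C%:E = gen c s by rewrite fineK.
have AE : A%:E = gen a s by rewrite fineK.
exists A, (fine (gen v s)), C; split; split => //.
- by rewrite -lee_fin CE.
- by rewrite -lee_fin CE.
- by rewrite -lee_fin CE.
- by rewrite -/G expr2; lra.
- by move=> n; rewrite -lee_fin AE.
Qed.

End renewal_equation.

(** * Solving the renewal equation by varying t *)

Section renewal_solution.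
Context (R : realType).
Variables (V : nat -> R) (a c : R -> nat -> R) (K : R -> R).
Hypothesis V0 : forall n, 0 <= V n.
Hypothesis a_gt0 : forall t n, 0 < t < 1 -> 0 < a t n.
Hypothesis a_le1 : forall t n, 0 < t < 1 -> a t n <= 1.
Hypothesis a_low : forall t, 0 < t < 1 -> exists2 e, 0 < e & forall n, e <= a t n.
Hypothesis c0 : forall t n, 0 < t < 1 -> 0 <= c t n.
Hypothesis c1 : forall t n, 0 < t < 1 -> c t n <= 1.
Hypothesis cK : forall t n, 0 < t < 1 -> \sum_(i < n) c t i.+1 <= K t.
Hypothesis a_mono : forall t n m, 0 < t < 1 -> (n <= m)%N -> a t m <= a t n.

(* v_n, for n > 0. *)
Definition block_weight t n : R := V n * t ^+ n.-1 * expR (- (n%:R * t)).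

Hypothesis renewal : forall t n, 0 < t < 1 -> (0 < n)%N ->
  1 + expR (- t) * conv (conv (a t) (block_weight t)) (a t) n =
  c t n + expR (- t) * conv (a t) (a t) n.

(** F will turn out to invert this map on (0, 1): it is the tree function, with coefficients
    m^(m-1)/m!, and v is the Borel distribution of parameter t. *)
Definition borel_map t : R := t * expR (- t).

Lemma gen_block_weight t s : 0 < t -> 0 <= s ->
  gen V (borel_map t * s) = (t%:E * gen (block_weight t) s)%E.
Proof.
move=> t0 s0; rewrite -genZ//; last first.
  by move=> k; rewrite /block_weight !mulr_ge0// ?expR_ge0// exprn_ge0// ltW.
apply: eq_eseriesr => n _; congr EFin.
rewrite /block_weight /borel_map !exprMn -expRM_natl exprS /=.
by rewrite mulrN; ring.
Qed.

Lemma gen_solution t s : 0 < t < 1 -> 0 < s < 1 -> exists A vs C : R,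
  [/\ gen (block_weight t) s = vs%:E, 0 <= C, C <= K t & C <= s / (1 - s)] /\
  [/\ s / (1 - s) + expR (- t) * A ^+ 2 * vs = C + expR (- t) * A ^+ 2,
      forall r, 0 <= r -> (forall n, r <= a t n) -> r * (s / (1 - s)) <= A,
      forall n, A <= n%:R + a t n * (s / (1 - s)) & 0 < A].
Proof.
move=> t01; have /andP[t0 t1] := t01.
have bw0 n : 0 <= block_weight t n.
  by rewrite /block_weight !mulr_ge0// ?expR_ge0// exprn_ge0// ltW.
exact: (gen_renewal (expR_gt0 (- t)) (fun n => a_gt0 n t01) (fun n => a_le1 n t01)
  bw0 (fun n => c0 n t01) (fun n => c1 n t01) (fun n => cK n t01)
  (fun n m => a_mono t01) (fun n => renewal t01)).
Qed.

(* With [s = (1 - d/t) e^d] one has [borel_map t * s = borel_map (t - d)]. *)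
Lemma shift_bounds (t d : R) : 0 < t < 1 -> 0 < d < t ->
  let s := (1 - d / t) * expR d in
  [/\ 0 < s < 1, borel_map t * s = borel_map (t - d),
      d * (1 - t) <= t * (1 - s) & t * (1 - s) <= d * (expR d - t)].
Proof.
move=> /andP[t0 t1] /andP[d0 dt] s.
have st : t * s = (t - d) * expR d.
  by rewrite /s mulrA mulrBr mulr1 mulrCA mulfV ?mulr1// gt_eqF.
have ts : t * (1 - s) = t - (t - d) * expR d by rewrite mulrBr mulr1 st.
have E0 := expR_gt0 d.
have E1 : 1 + d <= expR d by exact: expR_ge1Dx.
have E2 : expR d * (1 - d) <= 1.
  have := expR_ge1Dx (- d); rewrite expRN => H.
  by rewrite -ler_pdivlMl// mulr1; lra.
have H1 : d * (1 - t) <= t * (1 - s).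
  have h1 : 0 <= t * (expR d * d - (expR d - 1)) by rewrite mulr_ge0 ?(ltW t0)//; lra.
  have h2 : 0 <= d * (1 - t) * (expR d - 1).
    by rewrite !mulr_ge0 ?subr_ge0 ?ltW//; lra.
  rewrite ts; lra.
have s0 : 0 < s by rewrite -(pmulr_rgt0 _ t0) st mulr_gt0// subr_gt0.
have s1 : s < 1.
  by rewrite -subr_gt0 -(pmulr_rgt0 _ t0); apply: lt_le_trans H1; rewrite mulr_gt0// subr_gt0.
split=> //.
- by rewrite s0.
- by rewrite /borel_map mulrAC st opprB expRD expRN; ring.
- have h1 : 0 <= t * (expR d - 1 - d) by rewrite mulr_ge0 ?(ltW t0)//; lra.
  by rewrite ts; lra.
Qed.

(** Upper bound: C <= G forces the series of v at s to be at most 1, so F(u e^-u s) <= u, and for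
    each u in (t, 1) some s < 1 turns u e^-u into t e^-t. Lower bound: 1 minus that series equals (G
    - C) e^t / A^2, which is of order 1/G because the a_n are bounded away from 0; it vanishes as s
    tends to 1. *)
Lemma gen_borel_map t : 0 < t < 1 -> gen V (borel_map t) = t%:E.
Proof.
move=> t01; have /andP[t0 t1] := t01.
have vs1 u s : 0 < u < 1 -> 0 < s < 1 ->
    (gen V (borel_map u * s) <= u%:E)%E.
  move=> u01 s01; have /andP[u0 u1] := u01; have /andP[s0 s1] := s01.
  have [A [vs [C [[E C0 _ CG] [E2 _ _ A0]]]]] := gen_solution u01 s01.
  rewrite gen_block_weight ?(ltW s0)// E -EFinM lee_fin; apply: ler_piMr; first exact: ltW.
  have wA : 0 < expR (- u) * A ^+ 2 by rewrite mulr_gt0 ?expR_gt0// exprn_gt0.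
  by rewrite -subr_ge0 -(pmulr_rge0 _ wA); lra.
have up u : t < u < 1 -> (gen V (borel_map t) <= u%:E)%E.
  move=> /andP[tu u1].
  have u01 : 0 < u < 1 by rewrite u1 (lt_trans t0).
  have dut : 0 < u - t < u by rewrite subr_gt0 tu ltrBlDr ltrDl t0.
  have [s01 + _ _] := shift_bounds u01 dut.
  by rewrite opprB addrCA subrr addr0 => <-; exact: vs1.
have g0 : (0 <= gen V (borel_map t))%E.
  by apply: gen_ge0 => //; rewrite mulr_ge0 ?expR_ge0// ltW.
have gfin : gen V (borel_map t) \is a fin_num.
  rewrite ge0_fin_numE//; apply: (@le_lt_trans _ _ ((t + 1) / 2)%:E); last by rewrite ltry.
  by apply: up; apply/andP; split; lra.
rewrite -(fineK gfin); congr EFin.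
set x := fine _.
have xE : x%:E = gen V (borel_map t) by rewrite fineK.
apply/eqP; rewrite eq_le; apply/andP; split.
  rewrite leNgt; apply/negP => tx.
  have [x1|x1] := leP 1 x.
    have := @up ((t + 1) / 2) ltac:(apply/andP; split; lra).
    by rewrite -xE lee_fin; lra.
  have := @up ((t + x) / 2) ltac:(apply/andP; split; lra).
  by rewrite -xE lee_fin; lra.
have [e e0 ea] := a_low t01.
have low y : 0 < y -> t <= x + y.
  move=> y0.
  (* [k] is the constant in t (1 - vs) <= k/G, and [s] is chosen so that k/G = y. *)
  pose k := expR t * t / e ^+ 2.
  have k0 : 0 < k by rewrite divr_gt0 ?mulr_gt0 ?expR_gt0// exprn_gt0.
  have yk0 : 0 < y / k by rewrite divr_gt0.
  pose s := (1 + y / k)^-1.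
  have s0 : 0 < s by rewrite invr_gt0; lra.
  have s1 : s < 1 by rewrite invf_lt1; lra.
  have s01 : 0 < s < 1 by rewrite s0.
  have GE : s / (1 - s) = k / y.
    rewrite /s; field; rewrite !gt_eqF//=; lra.
  have [A [vs [C [[E C0 _ CG] [E2 eA _ A0]]]]] := gen_solution t01 s01.
  have EA := eA _ (ltW e0) ea.
  have : (t%:E * gen (block_weight t) s <= x%:E)%E.
    rewrite -gen_block_weight ?(ltW s0)// xE.
    rewrite /gen; apply: lee_nneseries => n *.
      rewrite lee_fin mulr_ge0// exprn_ge0// !mulr_ge0 ?expR_ge0// ltW//.
    rewrite lee_fin ler_wpM2l// lerXn2r ?nnegrE ?mulr_ge0 ?expR_ge0 ?(ltW t0) ?(ltW s0)//.
    by rewrite ler_piMr ?(ltW s1)// mulr_ge0 ?expR_ge0// ltW.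
  rewrite E -EFinM lee_fin => tvs.
  suff : t * (1 - vs) <= y by rewrite mulrBr; lra.
  have wA : 0 < expR (- t) * A ^+ 2 by rewrite mulr_gt0 ?expR_gt0// exprn_gt0.
  rewrite -(ler_pM2l wA) mulrCA.
  have -> : expR (- t) * A ^+ 2 * (1 - vs) = s / (1 - s) - C by lra.
  have kE : e ^+ 2 * k = expR t * t by rewrite mulrC divfK// gt_eqF// exprn_gt0.
  apply: (@le_trans _ _ (t * (k / y))).
    by rewrite ler_wpM2l ?(ltW t0)// GE; lra.
  have kyA : (e * (k / y)) ^+ 2 <= A ^+ 2.
    have ekA : e * (k / y) <= A by rewrite -GE.
    by rewrite lerXn2r ?nnegrE ?(ltW A0)// mulr_ge0 ?(ltW e0)// divr_ge0 ?(ltW k0) ?(ltW y0).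
  have : expR (- t) * (e * (k / y)) ^+ 2 * y <= expR (- t) * A ^+ 2 * y.
    by rewrite ler_wpM2r ?(ltW y0)// ler_wpM2l ?expR_ge0.
  apply: le_trans; rewrite exprMn [X in _ <= _ * (_ * X) * _]expr2.
  have -> : expR (- t) * (e ^+ 2 * (k / y * (k / y))) * y =
     expR (- t) * (e ^+ 2 * k) * (k / y) * (y / y) by field; rewrite gt_eqF.
  have -> : expR (- t) * (e ^+ 2 * k) = t.
    by rewrite kE mulrA -expRD addNr expR0 mul1r.
  by rewrite mulfV ?gt_eqF// mulr1.
by apply/ler_addgt0Pr.
Qed.

(** At this s the series of v is known exactly: F takes the value t - d at [borel_map (t - d)],
    hence vs = 1 - d/t. *)
Lemma shifted_solution t d : 0 < t < 1 -> 0 < d < t ->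
  let s := (1 - d / t) * expR d in exists A C : R,
  [/\ 0 <= C, C <= K t,
      s / (1 - s) - C = expR (- t) * A ^+ 2 * (d / t),
      forall r, 0 <= r -> (forall n, r <= a t n) -> r * (s / (1 - s)) <= A &
      forall n, A <= n%:R + a t n * (s / (1 - s))] /\ 0 < A.
Proof.
move=> t01 dt s; have /andP[t0 t1] := t01; have /andP[d0 dt'] := dt.
have [s01 bE _ _] := shift_bounds t01 dt.
have /andP[s0 s1] := s01.
have [A [vs [C [[E C0 CK _] [E2 rA nA A0]]]]] := gen_solution t01 s01.
have : (t%:E * gen (block_weight t) s)%E = (t - d)%:E.
  rewrite -gen_block_weight ?(ltW s0)// bE gen_borel_map//.
  by apply/andP; split; lra.
rewrite E -EFinM => -[tvs]; exists A, C; split=> //; split=> //.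
have -> : d / t = 1 - vs.
  have -> : vs = (t - d) / t by rewrite -tvs mulrAC mulfV ?gt_eqF ?mul1r.
  by rewrite mulrBl mulfV ?gt_eqF// opprB addrCA subrr addr0.
by move: E2; set G := s / (1 - s); lra.
Qed.

Lemma cvg_shift (t : R) : (1 - d / t) * expR d @[d --> 0^'+] --> (1 : R).
Proof.
apply: cvg_at_right_filter.
have cE : expR d @[d --> (0 : R)] --> (1 : R).
  by rewrite -[X in _ --> X]expR0; exact: continuous_expR.
have cd : 1 - d / t @[d --> (0 : R)] --> (1 : R).
  rewrite -[X in _ --> X]subr0; apply: cvgB; first exact: cvg_cst.
  by rewrite -[X in _ --> X](mul0r t^-1); apply: cvgM; [exact: cvg_id|exact: cvg_cst].
by rewrite -[X in _ --> X]mulr1; exact: cvgM.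
Qed.

(** From r G <= A and C >= 0 one gets e^-t r^2 G d/t <= 1; the upper bound of [shift_bounds] on t (1
    - s) then gives the claim as d tends to 0. *)
Lemma renewal_limit_le t r : 0 < t < 1 -> 0 <= r -> (forall n, r <= a t n) ->
  expR (- t) * r ^+ 2 <= 1 - t.
Proof.
move=> t01 r0 ra; have /andP[t0 t1] := t01.
have H d : 0 < d < t ->
    expR (- t) * r ^+ 2 * ((1 - d / t) * expR d) <= expR d - t.
  move=> dt; have /andP[d0 dt'] := dt.
  have [A [C [[C0 CK E rA _] A0]]] := shifted_solution t01 dt.
  have [/andP[s0 s1] _ _ Hs] := shift_bounds t01 dt.
  move: (rA r r0 ra) E s0 s1 Hs; set s := (1 - d / t) * expR d => rsA E s0 s1 Hs.
  have s1' : 0 < 1 - s by rewrite subr_gt0.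
  pose G := s / (1 - s); have G0 : 0 < G by rewrite divr_gt0.
  have GE : G * (1 - s) = s by rewrite divfK// gt_eqF.
  have dt0 : 0 < d / t by rewrite divr_gt0.
  have h1 : expR (- t) * (r * G) ^+ 2 * (d / t) <= G.
    apply: (@le_trans _ _ (expR (- t) * A ^+ 2 * (d / t))); last by rewrite -E -/G; lra.
    rewrite ler_wpM2r ?(ltW dt0)// ler_wpM2l ?expR_ge0//.
    by rewrite lerXn2r ?nnegrE ?(ltW A0)// mulr_ge0// ltW.
  have h2 : expR (- t) * r ^+ 2 * G * (d / t) <= 1.
    by rewrite -(ler_pM2r G0) mul1r; apply: le_trans h1; rewrite exprMn; lra.
  have h3 : expR (- t) * r ^+ 2 * s * d <= t * (1 - s).
    have : expR (- t) * r ^+ 2 * G * (d / t) * (t * (1 - s)) <= 1 * (t * (1 - s)).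
      by rewrite ler_wpM2r// mulr_ge0 ?ltW.
    rewrite mul1r; apply: le_trans.
    have -> : expR (- t) * r ^+ 2 * G * (d / t) * (t * (1 - s)) =
        expR (- t) * r ^+ 2 * (G * (1 - s)) * d by field; rewrite gt_eqF.
    by rewrite GE.
  by rewrite -(ler_pM2r d0); apply: (le_trans h3); rewrite [leRHS]mulrC.
have cE : expR d @[d --> 0^'+] --> (1 : R).
  by apply: cvg_at_right_filter; rewrite -[X in _ --> X]expR0; exact: continuous_expR.
have L : expR (- t) * r ^+ 2 * ((1 - d / t) * expR d) @[d --> 0^'+] -->
    expR (- t) * r ^+ 2 * 1.
  by apply: cvgM; [exact: cvg_cst|exact: cvg_shift].
have M : expR d - t @[d --> 0^'+] --> 1 - t by apply: cvgB => //; exact: cvg_cst.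
rewrite -[leLHS]mulr1; apply: (ler_cvg_to L M).
near=> d; apply: H; apply/andP; split; near: d; first exact: nbhs_right_gt.
exact: nbhs_right_lt.
Unshelve. all: by end_near. Qed.

(** This uses A <= n + a_n G and C <= K. Multiplying by (1-s)^2 keeps both sides bounded, and the
    terms n (1-s) and K (1-s) vanish in the limit. *)
Lemma renewal_limit_ge t n : 0 < t < 1 -> 1 - t <= expR (- t) * a t n ^+ 2.
Proof.
move=> t01; have /andP[t0 t1] := t01; have a0 := a_gt0 n t01.
pose f s := (s - K t * (1 - s)) * (1 - t).
pose g s := expR (- t) * (n%:R * (1 - s) + a t n * s) ^+ 2.
have H d : 0 < d < t -> f ((1 - d / t) * expR d) <= g ((1 - d / t) * expR d).
  move=> dt; have /andP[d0 dt'] := dt.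
  have [A [C [[C0 CK E _ nA] A0]]] := shifted_solution t01 dt.
  have [/andP[s0 s1] _ Hs _] := shift_bounds t01 dt.
  move: (nA n) E s0 s1 Hs; set s := (1 - d / t) * expR d => An E s0 s1 Hs.
  have s1' : 0 < 1 - s by rewrite subr_gt0.
  pose G := s / (1 - s); have G0 : 0 < G by rewrite divr_gt0.
  have GE : G * (1 - s) = s by rewrite divfK// gt_eqF.
  (* The lower bound on t (1 - s) may be multiplied by this factor only if the factor is
     nonnegative; in the other case the left side is at most 0. *)
  have [sK|sK] := leP (s - K t * (1 - s)) 0.
    apply: (@le_trans _ _ 0); first by rewrite mulr_le0_ge0// subr_ge0 ltW.
    by rewrite mulr_ge0 ?expR_ge0// sqr_ge0.
  have h1 : (G - K t) * t <= expR (- t) * (n%:R + a t n * G) ^+ 2 * d.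
    have : (G - C) * t = expR (- t) * A ^+ 2 * d.
      by rewrite E; field; rewrite gt_eqF.
    have : expR (- t) * A ^+ 2 * d <= expR (- t) * (n%:R + a t n * G) ^+ 2 * d.
      rewrite ler_wpM2r ?(ltW d0)// ler_wpM2l ?expR_ge0//.
      by rewrite lerXn2r ?nnegrE ?(ltW A0)// (le_trans (ltW A0)).
    have : 0 <= (K t - C) * t by rewrite mulr_ge0 ?subr_ge0 ?(ltW t0).
    lra.
  have h2 : (s - K t * (1 - s)) * (t * (1 - s)) <=
      expR (- t) * (n%:R * (1 - s) + a t n * s) ^+ 2 * d.
    have : (G - K t) * t * (1 - s) ^+ 2 <=
        expR (- t) * (n%:R + a t n * G) ^+ 2 * d * (1 - s) ^+ 2.
      by rewrite ler_wpM2r ?sqr_ge0.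
    have -> : (G - K t) * t * (1 - s) ^+ 2 =
        (G * (1 - s) - K t * (1 - s)) * (t * (1 - s)) by ring.
    have -> : expR (- t) * (n%:R + a t n * G) ^+ 2 * d * (1 - s) ^+ 2 =
        expR (- t) * (n%:R * (1 - s) + a t n * (G * (1 - s))) ^+ 2 * d by ring.
    by rewrite GE.
  rewrite -(ler_pM2r d0) /f /g; apply: le_trans h2.
  by rewrite -mulrA (mulrC (1 - t)) ler_wpM2l// ltW.
have cS := cvg_shift t.
have cS1 : 1 - (1 - d / t) * expR d @[d --> 0^'+] --> (1 - 1 : R).
  by apply: cvgB => //; exact: cvg_cst.
have L : f ((1 - d / t) * expR d) @[d --> 0^'+] --> f 1.
  apply: cvgM; last exact: cvg_cst.
  by apply: cvgB => //; apply: cvgM => //; exact: cvg_cst.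
have M : g ((1 - d / t) * expR d) @[d --> 0^'+] --> g 1.
  apply: cvgM; first exact: cvg_cst.
  rewrite expr2; under eq_fun do rewrite expr2.
  have : n%:R * (1 - (1 - d / t) * expR d) + a t n * ((1 - d / t) * expR d)
      @[d --> 0^'+] --> n%:R * (1 - 1) + a t n * 1.
    by apply: cvgD; apply: cvgM => //; exact: cvg_cst.
  by move=> cvgU; exact: cvgM.
have -> : 1 - t = f 1 by rewrite /f subrr mulr0 subr0 mul1r.
have -> : expR (- t) * a t n ^+ 2 = g 1 by rewrite /g subrr mulr0 add0r mulr1.
apply: (ler_cvg_to L M).
near=> d; apply: H; apply/andP; split; near: d; first exact: nbhs_right_gt.
exact: nbhs_right_lt.
Unshelve. all: by end_near. Qed.

End renewal_solution.

(** * Survival probability *)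

Section survival.
Context d (T : measurableType d) (R : realType) (P : probability T R).
Variable X : nat -> {RV P >-> R}.
Hypothesis iidX : iid_std_exponential X.

Local Notation Xs w := (fun k : nat => X k w).

Definition survival (t : R) : set T :=
  [set w | forall k, 0 <= iwalk t k.+1 (Xs w)].

Lemma iwalk_le (t u : R) k x : t <= u -> iwalk u k x <= iwalk t k x.
Proof.
move=> tu; apply: ler_sum => i _; apply: ler_sum => j _.
by rewrite lerD2l lerN2.
Qed.

Lemma measurable_survival t : measurable (survival t).
Proof.
rewrite (_ : survival t = \bigcap_(k in setT) [set w | 0 <= iwalk t k.+1 (Xs w)]).
  apply: bigcap_measurableType => k _; apply: measurable_le_set => //.
  by apply: measurable_iwalk => j _; exact: measurable_Xs.
by apply/seteqP; split=> w /= H k; [move=> _; exact: H|exact: (H k I)].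
Qed.

Let survival_upto t n := [set w | forall k, (k < n)%N -> 0 <= iwalk t k.+1 (Xs w)].

Let measurable_survival_upto t n : measurable (survival_upto t n).
Proof.
rewrite (_ : survival_upto t n =
    \bigcap_(k in [set k | (k < n)%N]) [set w | 0 <= iwalk t k.+1 (Xs w)]).
  apply: bigcap_measurableType => k _; apply: measurable_le_set => //.
  by apply: measurable_iwalk => j _; exact: measurable_Xs.
by apply/seteqP; split=> w /= H k; exact: H.
Qed.

Lemma survival_le t n : 0 <= t ->
  (P (survival t) <= (expR (- t))%:E * escape X t n)%E.
Proof.
move=> t0; apply: (@le_trans _ _ ((expR (- t))%:E * escape X t n.+1)%E); last first.
  by rewrite lee_wpmul2l// ?lee_fin ?expR_ge0// escape_nonincreasing.
rewrite -survival_probability//; apply: le_measure; rewrite ?inE//.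
- exact: measurable_survival.
- exact: measurable_survival_upto.
- by move=> w /= H k _; exact: H.
Qed.

(** Continuity from above along the events of surviving n steps. *)
Lemma survival_ge t (r : R) : 0 <= t ->
  (forall n, r%:E <= (expR (- t))%:E * escape X t n)%E ->
  (r%:E <= P (survival t))%E.
Proof.
move=> t0 rle.
have cvgS : P (survival_upto t n) @[n --> \oo] --> P (survival t).
  have -> : survival t = \bigcap_n survival_upto t n.
    apply/seteqP; split=> w /= H k; first by move=> _ j _; exact: H.
    by apply: (H k.+1 I).
  apply: nonincreasing_cvg_mu.
  - by rewrite (le_lt_trans (probability_le1 _ _)) ?ltry.
  - by move=> n; exact: measurable_survival_upto.
  - by apply: bigcap_measurableType => n _; exact: measurable_survival_upto.
  - move=> n m nm; apply/subsetPset => w /= H k kn; apply: H.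
    exact: leq_trans kn nm.
rewrite -(cvg_lim _ cvgS)//; apply: lime_ge; first by apply/cvg_ex; exists (P (survival t)).
exists 1%N => // n /= n0; rewrite survival_probability//.
Qed.

Let a t n : R := fine (escape X t n).

Let escapeE t n : escape X t n = (a t n)%:E.
Proof. by rewrite fineK// escape_fin_num. Qed.

Lemma bridge_volume_ge0 n : (0 <= bridge_volume X n)%E.
Proof. by apply: integral_ge0 => w _; rewrite mule_ge0// lee_fin expR_ge0. Qed.

Lemma escape_gt0 t n : 0 < t < 1 -> 0 < a t n.
Proof.
move=> t01; have [e e0 ea] := escape_lower_bound iidX t01.
rewrite -lte_fin -escapeE; apply: (@lt_le_trans _ _ e%:E); first by rewrite lte_fin.
by apply: le_trans (ea n.+1 isT) _; exact: escape_nonincreasing.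
Qed.

(** At t = 1/2 the volume multiplied by positive factors is the probability of a contact pair, so it
    cannot be infinite. *)
Lemma bridge_volume_fin n : (0 < n)%N -> bridge_volume X n \is a fin_num.
Proof.
move=> n0; pose t : R := 2^-1.
have t01 : 0 < t < 1 by rewrite /t invr_gt0 ltr0n invf_lt1 ?ltr0n// ltr1n.
have /andP[t0 _] := t01.
rewrite ge0_fin_numE ?bridge_volume_ge0// ltNge leye_eq; apply/negP => /eqP Voo.
have := @probability_contact_pair _ _ _ _ X t iidX (ltW t0) n.+2 1 n.+1
  ltac:(lia) (ltnSn _).
have -> : (n.+1 - 1 = n)%N by lia.
rewrite bridge_weightE// Voo !escapeE.
rewrite gt0_muley ?lte_fin ?mulr_gt0 ?expR_gt0 ?exprn_gt0//.
rewrite gt0_mulye ?lte_fin ?escape_gt0//.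
rewrite gt0_muley ?lte_fin ?escape_gt0// gt0_muley ?lte_fin ?expR_gt0// => PE.
by have := probability_le1 P (measurable_contact_pair X t n.+2 1 n.+1); rewrite PE leye_eq.
Qed.

Lemma renewal_equation t N : 0 < t < 1 -> (0 < N)%N ->
  let bw := block_weight (fun n => fine (bridge_volume X n)) t in
  1 + expR (- t) * conv (conv (fun n => a t n) bw) (fun n => a t n) N =
  fine (P (no_contact X t N)) +
    expR (- t) * conv (fun n => a t n) (fun n => a t n) N.
Proof.
move=> t01 N0 bw; have /andP[t0 t1] := t01.
have t0' := ltW t0.
have := renewal_identity X t N0.
have -> : (\sum_(1 <= j < N) \sum_(1 <= i < j)
    P [set w | contact_pair t N (Xs w) i j])%E =
    (expR (- t) * conv (conv (fun n => a t n) bw) (fun n => a t n) N)%:E.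
  rewrite /conv mulr_sumr -sumEFin; apply: eq_big_nat => j /andP[j1 jN].
  rewrite mulr_suml mulr_sumr -sumEFin; apply: eq_big_nat => i /andP[i1 ij].
  rewrite (probability_contact_pair iidX)// ?i1// bridge_weightE//.
  rewrite -(fineK (@bridge_volume_fin (j - i) _)) ?subn_gt0// !escapeE -!EFinM.
  congr EFin; rewrite /bw /block_weight.
  (* One of the two factors e^-t of [probability_contact_pair] is absorbed into the block weight. *)
  have -> : expR (- ((j - i)%:R * t)) = expR (- ((j - i).-1%:R * t)) * expR (- t).
    rewrite -expRD; congr expR.
    have {1}-> : (j - i = (j - i).-1 + 1)%N by lia.
    by rewrite natrD; ring.
  by rewrite expRD; ring.
have -> : (\sum_(1 <= i < N) P [set w | contact t N (Xs w) i])%E =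
    (expR (- t) * conv (fun n => a t n) (fun n => a t n) N)%:E.
  rewrite /conv mulr_sumr -sumEFin; apply: eq_big_nat => i /andP[i1 iN].
  by rewrite (probability_contact iidX)// ?i1// !escapeE -!EFinM.
rewrite -(fineK (fin_num_measure P _ (measurable_no_contact X t N))) -!EFinD.
by move=> [].
Qed.

Lemma no_contact_sum t n : 0 < t < 1 ->
  \sum_(i < n) fine (P (no_contact X t i.+1)) <= (1 - chernoff_rate t)^-1.
Proof.
move=> t01; have /andP[r0 r1] := chernoff_rate_bounds t01.
apply: (@le_trans _ _ (\sum_(i < n) chernoff_rate t ^+ i)).
  apply: ler_sum => i _; rewrite -lee_fin fineK.
    exact: (no_contact_probability iidX t01).
  by apply: fin_num_measure; exact: measurable_no_contact.
rewrite -[leRHS]div1r ler_pdivlMr ?subr_gt0//.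
by have := subrX1 (chernoff_rate t) n; have := exprn_ge0 n r0; lra.
Qed.

(** The two bounds come from different sides: e^t P(survival) is a lower bound of all a_n, and each
    e^-t a_n dominates the claimed value. Both are compared after squaring. *)
Lemma survival_value_open t : 0 < t < 1 ->
  P (survival t) = (Num.sqrt (1 - t) * expR (- t / 2))%:E.
Proof.
move=> t01; have /andP[t0 t1] := t01; have t0' := ltW t0.
pose V n := fine (bridge_volume X n).
pose aa := a.
pose c (u : R) n := fine (P (no_contact X u n)).
pose K (u : R) := (1 - chernoff_rate u)^-1.
have V0 n : 0 <= V n by rewrite fine_ge0// bridge_volume_ge0.
have aa_gt0 u n : 0 < u < 1 -> 0 < aa u n by exact: escape_gt0.
have aa_le1 u n : 0 < u < 1 -> aa u n <= 1.
  by move=> _; rewrite -lee_fin -escapeE escape_le1.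
have aa_low u : 0 < u < 1 -> exists2 e, 0 < e & forall n, e <= aa u n.
  move=> u01; have [e e0 ea] := escape_lower_bound iidX u01; exists e => // n.
  rewrite -lee_fin -escapeE; apply: le_trans (ea n.+1 isT) _.
  exact: escape_nonincreasing.
have c0 u n : 0 < u < 1 -> 0 <= c u n by move=> _; rewrite fine_ge0.
have c1 u n : 0 < u < 1 -> c u n <= 1.
  move=> _; have mN := measurable_no_contact X u n.
  by rewrite -lee_fin fineK ?fin_num_measure// probability_le1.
have cK u n : 0 < u < 1 -> \sum_(i < n) c u i.+1 <= K u by exact: no_contact_sum.
have aa_mono u n m : 0 < u < 1 -> (n <= m)%N -> aa u m <= aa u n.
  by move=> _ nm; rewrite -lee_fin -!escapeE escape_nonincreasing.
have ren u n : 0 < u < 1 -> (0 < n)%N ->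
    1 + expR (- u) * conv (conv (aa u) (block_weight V u)) (aa u) n =
    c u n + expR (- u) * conv (aa u) (aa u) n by exact: renewal_equation.
pose v := Num.sqrt (1 - t) * expR (- t / 2).
have v0 : 0 <= v by rewrite mulr_ge0 ?sqrtr_ge0 ?expR_ge0.
have v2 : v ^+ 2 = (1 - t) * expR (- t).
  rewrite exprMn sqr_sqrtr ?subr_ge0 ?(ltW t1)// -expRM_natl; congr (_ * expR _).
  by field.
have Pfin : P (survival t) \is a fin_num.
  by apply: fin_num_measure; exact: measurable_survival.
pose p := fine (P (survival t)).
have pE : P (survival t) = p%:E by rewrite fineK.
have p0 : 0 <= p by rewrite fine_ge0.
have eNe : expR (- t) * expR t = 1 by rewrite -expRD addNr expR0.
apply/eqP; rewrite eq_le; apply/andP; split.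
  rewrite pE lee_fin -/v.
  have H := @renewal_limit_le _ V aa c K V0 aa_gt0 aa_le1 aa_low c0 c1 cK aa_mono ren
    t (expR t * p) t01.
  rewrite -ler_sqr ?nnegrE// v2.
  have -> : p ^+ 2 = expR (- t) * (expR t * p) ^+ 2 * expR (- t).
    have -> : expR (- t) * (expR t * p) ^+ 2 * expR (- t) =
      (expR (- t) * expR t) ^+ 2 * p ^+ 2 by ring.
    by rewrite eNe expr1n mul1r.
  rewrite ler_wpM2r ?expR_ge0//; apply: H; first by rewrite mulr_ge0 ?expR_ge0.
  move=> n; have := survival_le n t0'; rewrite pE escapeE -EFinM lee_fin => pn.
  have := ler_wpM2l (expR_ge0 t) pn.
  by rewrite mulrA (mulrC (expR t) (expR _)) eNe mul1r.
apply: survival_ge => // n; rewrite escapeE -EFinM lee_fin -/v.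
have H := @renewal_limit_ge _ V aa c K V0 aa_gt0 aa_le1 aa_low c0 c1 cK aa_mono ren
  t n t01.
rewrite -ler_sqr ?nnegrE ?mulr_ge0 ?expR_ge0 ?(ltW (aa_gt0 t n t01))// v2.
rewrite exprMn mulrC (_ : expR (- t) ^+ 2 * _ = expR (- t) * (expR (- t) * aa t n ^+ 2)).
  by rewrite ler_wpM2l ?expR_ge0.
by rewrite expr2 mulrA.
Qed.

Lemma survival_value t : 0 <= t <= 1 ->
  P (survival t) = (Num.sqrt (1 - t) * expR (- t / 2))%:E.
Proof.
move=> /andP[]; rewrite le_eqVlt => /orP[/eqP <- _|t0].
  rewrite subr0 sqrtr1 mul1r oppr0 mul0r expR0.
  have mS := measurable_survival 0.
  apply/eqP; rewrite eq_le probability_le1//=.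
  apply/lee_addgt0Pr => e e0.
  (* [survival u] is contained in [survival 0], and its probability is at least 1 - u because e^-u
     >= 1 - u. *)
  pose u := Num.min (e / 2) (2^-1) : R.
  have u01 : 0 < u < 1.
    by rewrite /u lt_min gt_min !divr_gt0//= invr_gt0 ltr0n/= invf_lt1 ?ltr0n// ltr1n orbT.
  have ue : u <= e by rewrite /u ge_min; apply/orP; left; lra.
  have /andP[u0 u1] := u01.
  apply: (@le_trans _ _ (P (survival u) + e%:E)%E); last first.
    rewrite leeD2r//; apply: le_measure; [by rewrite inE; exact: measurable_survival|by rewrite inE; exact: measurable_survival|].
    by move=> w /= H k; apply: le_trans (H k) _; apply: iwalk_le; exact: ltW.
  rewrite survival_value_open// -EFinD lee_fin.
  suff : 1 - u <= Num.sqrt (1 - u) * expR (- u / 2) by lra.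
  have u1' : 0 <= 1 - u by rewrite subr_ge0 ltW.
  rewrite -ler_sqr ?nnegrE ?mulr_ge0 ?sqrtr_ge0 ?expR_ge0//.
  rewrite exprMn sqr_sqrtr// -expRM_natl expr2 ler_wpM2l//.
  have -> : 2%:R * (- u / 2) = - u by field.
  exact: expR_ge1Dx.
rewrite le_eqVlt => /orP[/eqP ->|t1]; last by apply: survival_value_open; rewrite t0.
rewrite subrr sqrtr0 mul0r; apply/eqP; rewrite eq_le measure_ge0 andbT.
apply/lee_addgt0Pr => e e0; rewrite add0e.
pose x := Num.min e (2^-1) : R.
have x0 : 0 < x by rewrite lt_min e0 invr_gt0 ltr0n.
have xe : x <= e by rewrite ge_min lexx.
have x1 : x < 1 by rewrite gt_min invf_lt1 ?ltr0n// ltr1n orbT.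
(* [survival 1] is contained in [survival u], and this u makes the square root equal to x. *)
pose u := 1 - x ^+ 2.
have x2 : 0 < x ^+ 2 < 1 by rewrite exprn_gt0// exprn_ilt1// ltW.
have u01 : 0 < u < 1 by rewrite /u; apply/andP; split; lra.
apply: (@le_trans _ _ (P (survival u))).
  apply: le_measure; [by rewrite inE; exact: measurable_survival|by rewrite inE; exact: measurable_survival|].
  move=> w /= H k; apply: le_trans (H k) _; apply: iwalk_le.
  by case/andP: u01 => _ /ltW.
rewrite survival_value_open// lee_fin /u opprB addrCA subrr addr0 sqrtr_sqr ger0_norm ?(ltW x0)//.
apply: le_trans xe; rewrite ler_piMr ?(ltW x0)// -[leRHS]expR0 ler_expR.
by case/andP: u01; rewrite /u; lra.
Qed.

End survival.

Theorem mainTheorem1 (d : measure_display) (T : measurableType d)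
    (R : realType) (P : probability T R) (X : nat -> {RV P >-> R})
    (iidX : iid_std_exponential X) (t : R) (t0 : 0 <= t) (t1 : t <= 1) :
  P [set w | (t%:E <= ereal_inf
       [set (2 / (k * (k + 1))%:R * \sum_(1 <= i < k.+1) psum X i w)%:E
          | k in [set k : nat | (1 <= k)%N]])%E] =
  P [set w | (0 <= ereal_inf
       [set (\sum_(1 <= i < k.+1) (psum X i w - i%:R * t))%:E
          | k in [set k : nat | (1 <= k)%N]])%E]
  /\
  P [set w | (0 <= ereal_inf
       [set (\sum_(1 <= i < k.+1) (psum X i w - i%:R * t))%:E
          | k in [set k : nat | (1 <= k)%N]])%E] =
  (Num.sqrt (1 - t) * expR (- t / 2))%:E.
Proof.
have infP (r : R) (F : nat -> R) :
    (r%:E <= ereal_inf [set (F k)%:E | k in [set k : nat | (1 <= k)%N]])%E <->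
    forall k, r <= F k.+1.
  split=> [rF k|rF].
    by rewrite -lee_fin; apply: le_trans rF _; apply: ereal_inf_lbound; exists k.+1.
  by apply/ereal_infP => _ [[//|k] _ <-]; rewrite lee_fin.
have walkE k w : \sum_(1 <= i < k.+1) (psum X i w - i%:R * t) =
    iwalk t k (fun j => X j w).
  rewrite big_add1 big_mkord; apply: eq_bigr => i _.
  by rewrite /drift sumrB sumr_const card_ord mulr_natl.
have sum_nat k : \sum_(1 <= i < k.+1) i%:R = (k * (k + 1))%:R / 2 :> R.
  elim: k => [|k IH]; first by rewrite big_geq// mul0n mul0r.
  by rewrite big_nat_recr//= IH -[k.+1]addn1 !(natrM, natrD); field.
have survE w : (0 <= ereal_inf [set (\sum_(1 <= i < k.+1) (psum X i w - i%:R * t))%:E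
    | k in [set k : nat | (1 <= k)%N]])%E <-> survival X t w.
  apply: iff_trans (infP 0 (fun k => \sum_(1 <= i < k.+1) (psum X i w - i%:R * t))) _.
  split=> H.
    by move=> j; rewrite -walkE; exact: (H j).
  by move=> j; rewrite walkE; exact: (H j).
split; last first.
  rewrite -(survival_value iidX); last by rewrite t0.
  by congr (P _); apply/seteqP; split=> w /= /survE.
(* As 1 + ... + k = k (k+1)/2, the k-th inequalities of the two events differ by a positive factor,
   so the events coincide. *)
congr (P _); apply/seteqP; split=> w /=.
  move=> /(infP t (fun k => 2 / (k * (k + 1))%:R * \sum_(1 <= i < k.+1) psum X i w)) H.
  apply/survE => k; rewrite -walkE sumrB -mulr_suml sum_nat.
  have c0 : 0 < (k.+1 * (k.+1 + 1))%:R :> R by rewrite ltr0n muln_gt0 addn1.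
  by have := H k; rewrite mulrAC ler_pdivlMr//; lra.
move=> /survE H.
apply/(infP t (fun k => 2 / (k * (k + 1))%:R * \sum_(1 <= i < k.+1) psum X i w)) => k.
have c0 : 0 < (k.+1 * (k.+1 + 1))%:R :> R by rewrite ltr0n muln_gt0 addn1.
rewrite mulrAC ler_pdivlMr//.
by have := H k; rewrite -walkE sumrB -mulr_suml sum_nat; lra.
Qed.
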